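(* Let $p\in(0,1)$. With probability at least $1-p$, the regret of UCBVI-CH with external samples (described below) satisfies \[ \mathrm{Regret}(K)\le\frac{SAH^2}{N+1}+e(H+1)\sqrt{KL_N}+60\sqrt{\frac{2H-1}{N+2H-1}}\,H^{3/2}L_N\sqrt{SAK}+15\,\frac{2H-1}{N+2H-1}\,S^2AH^2L_N^2, \] where $L_N=\ln(5SAK(H+N)/p)$.
   Context: Single-task episodic setting: an MDP $(\mathcal S,\mathcal A,H,P,r)$ with finite state space ($|\mathcal S|=S$), finite action space ($|\mathcal A|=A$), horizon $H$, unknown transition $P$ and known deterministic reward $r:\mathcal S\times\mathcal A\to[0,1]$, played for $K$ episodes with initial states $s_1^k$. $\mathrm{Regret}(K)=\sum_{k=1}^K[V_1^*-V_1^{\pi_k}](s_1^k)$, where $V_1^\pi$ is the expected total $H$-step reward of $\pi$ and $V_1^*$ the optimal one. It is assumed that $SAKH$ is large enough that the logarithmic factor exceeds $1$. UCBVI-CH with external samples (parameter integer $N\ge1$): maintain collections $\mathcal H$ (learner's own transitions) and $\mathcal B$ (external transitions), both initially empty. At the start of each episode $k$, for each $(s,a)$ an oracle draws $N$ i.i.d. samples $s'\sim P(\cdot|s,a)$ and adds $(s,a,s')$ to $\mathcal B$. Then compute from $\mathcal H\cup\mathcal B$ the counts and empirical transitions $\hat P_k$ and, by backward induction, $V_{k,H+1}=0$, $Q_{k,h}(s,a)=\min\{H,r(s,a)+\sum_{s'}\hat P_k(s'|s,a)V_{k,h+1}(s')+b_k(s,a)\}$, $V_{k,h}(s)=\max_aQ_{k,h}(s,a)$,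 with bonus $b_k(s,a)=7HL_N\sqrt{1/(N_k(s,a)+kN)}$, where $N_k(s,a)$ is the number of visits to $(s,a)$ in the learner's own trajectories before episode $k$. In episode $k$ the learner plays $a_h=\arg\max_aQ_{k,h}(s_h,a)$ and adds each transition $(s_h,a_h,s_{h+1})$ to $\mathcal H$. *)

(* Defs.v *)
From HB Require Import structures.
From mathcomp Require Import all_boot all_order all_algebra.
From mathcomp Require Import reals.
From mathcomp.analysis Require Import sequences exp.
Set Implicit Arguments. Unset Strict Implicit. Unset Printing Implicit Defensive.
Import Order.TTheory GRing.Theory Num.Theory.
Local Open Scope ring_scope.

(* UCBVI-CH with external samples, single task, episodic MDP.
   Conventions:
   - episodes are indexed by jo : 'I_K, i.e. k = jo + 1;
   - steps are indexed by h : 'I_H, i.e. step h+1 of the paper;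
   - Q/V functions are indexed by the number m of remaining steps:
     Q_{k,h} of the paper is [Qhat .. (H + 1 - h)], V_{H+1} = 0 is m = 0;
   - argmax with an arbitrary (quantified) tie-breaking rule [pick]
     satisfying [forall f a, f a <= f (pick f)], so that
     max_a f a = f (pick f). *)

Section UCBVI.
Variable R : realType.
Variables (S A : finType) (H K N : nat).
Variable P : S -> A -> S -> R.
Variable r : S -> A -> R.
Variable init : 'I_K -> S.
Variable p : R.
Variable pick : (A -> R) -> A.

Definition maxA (f : A -> R) : R := f (pick f).

Definition LN : R :=
  ln ((5 * #|S| * #|A| * K * (H + N))%:R / p).

Fixpoint Qhat (Ph : S -> A -> S -> R) (b : S -> A -> R) (m : nat) : S -> A -> R :=
  match m with
  | 0 => fun _ _ => 0
  | m'.+1 => fun s a =>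
      Num.min H%:R (r s a + \sum_(s' : S) Ph s a s' * maxA (Qhat Ph b m' s') + b s a)
  end.

Fixpoint Qstar (m : nat) : S -> A -> R :=
  match m with
  | 0 => fun _ _ => 0
  | m'.+1 => fun s a => r s a + \sum_(s' : S) P s a s' * maxA (Qstar m' s')
  end.

Definition Vstar (m : nat) (s : S) : R := maxA (Qstar m s).

Fixpoint Vpol (Q : nat -> S -> A -> R) (m : nat) : S -> R :=
  match m with
  | 0 => fun _ => 0
  | m'.+1 => fun s =>
      let a := pick (Q m'.+1 s) in r s a + \sum_(s' : S) P s a s' * Vpol Q m' s'
  end.

(* ---- Sample space of one run of the algorithm ----
   Episode outcome: the N external samples drawn for each (s,a) at the start
   of the episode, and the successive states s_2, ..., s_{H+1} of the
   learner's trajectory (s_{h+2} stored at index h). *)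
Definition Ep := ({ffun S * A * 'I_N -> S} * {ffun 'I_H -> S})%type.
Definition Om := {ffun 'I_K -> Ep}.

Definition cur (w : Om) (jo : 'I_K) (h : 'I_H) : S :=
  match val h with
  | 0 => init jo
  | h'.+1 => if (insub h' : option 'I_H) is Some i then (w jo).2 i else init jo
  end.

(* number of external transitions (s,a,s') in B at episode jo (after the
   oracle's draw at the start of episode jo) *)
Definition extCount (w : Om) (jo : 'I_K) (s : S) (a : A) (s' : S) : nat :=
  \sum_(j < K | (j <= jo)%N) \sum_(i < N) ((w j).1 (s, a, i) == s').

(* given own counts cH (transitions in H before episode jo) *)
Definition Nvis (cH : S -> A -> S -> nat) (s : S) (a : A) : nat :=
  \sum_(s' : S) cH s a s'.

Definition ntot (cH : S -> A -> S -> nat) (jo : 'I_K) (s : S) (a : A) : nat :=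
  (Nvis cH s a + jo.+1 * N)%N.

Definition Phat (w : Om) (jo : 'I_K) (cH : S -> A -> S -> nat)
  (s : S) (a : A) (s' : S) : R :=
  (cH s a s' + extCount w jo s a s')%:R / (ntot cH jo s a)%:R.

Definition bonus (jo : 'I_K) (cH : S -> A -> S -> nat) (s : S) (a : A) : R :=
  7 * H%:R * LN * Num.sqrt (1 / (Nvis cH s a + jo.+1 * N)%:R).

Definition Qk (w : Om) (jo : 'I_K) (cH : S -> A -> S -> nat) : nat -> S -> A -> R :=
  Qhat (Phat w jo cH) (bonus jo cH).

Definition act (w : Om) (jo : 'I_K) (cH : S -> A -> S -> nat) (h : 'I_H) : A :=
  pick (Qk w jo cH (H - h) (cur w jo h)).

Definition epCount (w : Om) (jo : 'I_K) (cH : S -> A -> S -> nat)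
  (s : S) (a : A) (s' : S) : nat :=
  \sum_(h < H) ((cur w jo h, act w jo cH h, (w jo).2 h) == (s, a, s')).

Fixpoint ownCounts (w : Om) (j : nat) : S -> A -> S -> nat :=
  match j with
  | 0 => fun _ _ _ => 0%N
  | j'.+1 => fun s a s' =>
      (ownCounts w j' s a s' +
       if (insub j' : option 'I_K) is Some jo
       then epCount w jo (ownCounts w j') s a s' else 0)%N
  end.

Definition cHk (w : Om) (jo : 'I_K) : S -> A -> S -> nat := ownCounts w jo.

Definition mass (w : Om) : R :=
  \prod_(jo < K)
    ((\prod_(x : S * A * 'I_N) P x.1.1 x.1.2 ((w jo).1 x)) *
     \prod_(h < H) P (cur w jo h) (act w jo (cHk w jo) h) ((w jo).2 h)).

Definition Prob (E : pred Om) : R := \sum_(w : Om | E w) mass w.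

Definition regret (w : Om) : R :=
  \sum_(jo < K)
    (Vstar H (init jo) - Vpol (Qk w jo (cHk w jo)) H (init jo)).

Definition regret_bound : R :=
  let S' := #|S|%:R in let A' := #|A|%:R in
  let H' := H%:R in let K' := K%:R in let N' := N%:R in
  S' * A' * H' ^+ 2 / (N' + 1)
  + expR 1 * (H' + 1) * Num.sqrt (K' * LN)
  + 60 * Num.sqrt ((2 * H' - 1) / (N' + 2 * H' - 1)) * (H' * Num.sqrt H') * LN
       * Num.sqrt (S' * A' * K')
  + 15 * ((2 * H' - 1) / (N' + 2 * H' - 1)) * S' ^+ 2 * A' * H' ^+ 2 * LN ^+ 2.

End UCBVI.

(* Main.v *)
Require Import Defs.
From HB Require Import structures.
From mathcomp Require Import all_boot all_order all_algebra.
From mathcomp Require Import boolp reals.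
From mathcomp.analysis Require Import sequences exp.
From mathcomp Require Import ring lra zify.
Import Order.TTheory GRing.Theory Num.Theory.
Local Open Scope ring_scope.

(* The bonus dominates the Hoeffding error of the empirical transitions on the
   fixed functions V*_m, so Qhat is optimistic.  A multiplicative Chernoff bound
   Phat(T) <= (1 + 9/(20H)) P(T) + O(H (L + S) / n), uniform over sets T of
   states, handles the random function Vhat - V*; its relative error compounds
   to (1 + 9/(20H))^H <= 8/5 over an episode.  Hence the regret of an episode is
   at most the expected cost of its trajectory, where a step with n observations
   costs O(H L / sqrt n + S H^2 L / n), clipped at H at every step.

   Expected costs are compared with the costs along the actual trajectories by
   an exponential supermartingale with one increment per episode, for the total
   cost of the episode capped at O(H); an Azuma bound step by step would lose a
   factor sqrt H in the term H sqrt (K L).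

   In episode k one has n >= k N, whence, as soon as k N >= 5 H, the visits up
   to and including episode k number at most (6/5) (H / (H + N)) n.  This gives
   the factor (2H-1)/(N+2H-1) in the pigeonhole sums; the at most 5 H / N earlier
   episodes are paid H each.

   All random estimates have the form X_i < t_i with E exp X_i <= 1, so they
   hold together by one application of Markov's inequality to the sum of the
   exp (X_i - t_i). *)

(** * Elementary bounds on the exponential and numerical bounds on e *)

Lemma expR_le1DxDxx (R : realType) (x : R) :
  -2^-1 <= x <= 2^-1 -> expR x <= 1 + x + x ^+ 2.
Proof.
move=> /andP[xl xu].
have h : 1 - x / 4 <= expR (- (x / 4)) by exact: expR_ge1Dx.
have h0 : 0 < 1 - x / 4 by lra.
have e4 : expR (- x) = expR (- (x / 4)) ^+ 4.
  by rewrite -expRM_natl; congr expR; field.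
have h4 : (1 - x / 4) ^+ 4 <= expR (- x) by rewrite e4 lerXn2r// nnegrE; lra.
have h40 : 0 < (1 - x / 4) ^+ 4 by rewrite exprn_gt0.
have -> : expR x = (expR (- x))^-1 by rewrite expRN invrK.
rewrite -[leLHS]div1r ler_pdivrMr ?expR_gt0//.
apply: le_trans (_ : (1 + x + x ^+ 2) * (1 - x / 4) ^+ 4 <= _); last first.
  by rewrite ler_wpM2l//; have := sqr_ge0 x; lra.
rewrite -subr_ge0.
(* Factoring out [x ^+ 2] leaves an affine part that is at least 1/32 for [x <= 1/2], plus a
   nonnegative term. *)
have -> : (1 + x + x ^+ 2) * (1 - x / 4) ^+ 4 - 1 =
  x ^+ 2 * ((3 / 8 - 11 / 16 * x) + x ^+ 2 * ((81 - 15 * x) + x ^+ 2) / 256) by field.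
have := sqr_ge0 x => x2.
rewrite mulr_ge0 // addr_ge0 //; first by lra.
rewrite divr_ge0 // mulr_ge0 // addr_ge0 //; lra.
Qed.

Lemma expR_ge1DxDxx2 (R : realType) (x : R) :
  0 <= x -> 1 + x + x ^+ 2 / 2 <= expR x.
Proof.
move=> x0; rewrite /expR.
apply: le_trans (_ : series (exp_coeff x) 3 <= _).
  rewrite /series/= !big_nat_recr//= big_nil /exp_coeff/= !factS fact0 expr0 expr1.
  by rewrite -[(1 + 1)%R]/2%N !muln1 add0r !divr1 lexx.
apply: nondecreasing_cvgn_le; last exact: is_cvg_series_exp_coeff.
by apply: nondecreasing_series => n _ _; exact: exp_coeff_ge0.
Qed.

(** The product of [1 - x + x ^+ 2 / 2] and [1 + x + x ^+ 2 / 2] is [1 + x ^+ 4 / 4], hence at least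
    1. *)
Lemma expRN_le1BxDxx2 (R : realType) (x : R) :
  0 <= x -> expR (- x) <= 1 - x + x ^+ 2 / 2.
Proof.
move=> x0; rewrite expRN -[leLHS]div1r ler_pdivrMr ?expR_gt0//.
have := expR_ge1DxDxx2 _ _ x0.
move=> /(ler_wpM2l (_ : 0 <= 1 - x + x ^+ 2 / 2)) h.
by apply: le_trans (h _); have := sqr_ge0 x; nra.
Qed.

Lemma expR1_gt (R : realType) : 261 / 100 < expR 1 :> R.
Proof.
have -> : 1 = 16%:R * (1 / 16) :> R by field.
rewrite expRM_natl; apply: lt_le_trans (_ : (17 / 16) ^+ 16 <= _); first by lra.
apply: lerXn2r; rewrite ?nnegrE ?expR_ge0//; first by lra.
by apply: le_trans (expR_ge1Dx _); lra.
Qed.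

Lemma expR1_le (R : realType) : expR 1 <= 25/8 :> R.
Proof.
have -> : 1 = 2%:R * (1 / 2) :> R by field.
rewrite expRM_natl.
have := expR_le1DxDxx R (1/2).
have := expR_ge0 (1/2 : R); set e := expR _ => e0 h.
have {h} : e <= 7/4 by apply: le_trans (h _) _; lra.
nra.
Qed.

Lemma expR_9_20_le (R : realType) : expR (9 / 20) <= 8 / 5 :> R.
Proof.
have -> : 9 / 20 = 9%:R * (1 / 20) :> R by field.
rewrite expRM_natl.
have h : expR (1/20) <= 421/400 :> R by apply: le_trans (expR_le1DxDxx R (1/20) _) _; lra.
apply: le_trans (_ : (421/400) ^+ 9 <= _); last by lra.
by rewrite lerXn2r// ?nnegrE ?expR_ge0//; lra.
Qed.

(** * Sums over adapted processes *)

Definition upd {T : Type} {K : nat} (w : {ffun 'I_K -> T}) (n : 'I_K) (e : T) :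
  {ffun 'I_K -> T} := [ffun i => if i == n then e else w i].

(** Stands in for the filtration: a quantity is adapted when it takes equal values on runs related
    by [agree]. *)
Definition agree {T : eqType} {K : nat} (n : nat) (w w' : {ffun 'I_K -> T}) : bool :=
  [forall i : 'I_K, (i < n)%N ==> (w i == w' i)].

Lemma agreeP (T : eqType) (K n : nat) (w w' : {ffun 'I_K -> T}) :
  reflect (forall i : 'I_K, (i < n)%N -> w i = w' i) (agree n w w').
Proof.
apply: (iffP forallP) => h i; first by move=> lin; have /implyP/(_ lin)/eqP := h i.
by apply/implyP => /h ->.
Qed.

Lemma upd_same (T : Type) (K : nat) (w : {ffun 'I_K -> T}) (n : 'I_K) e : upd w n e n = e.
Proof. by rewrite ffunE eqxx. Qed.

Lemma upd_lt (T : Type) (K : nat) (w : {ffun 'I_K -> T}) (n i : 'I_K) e :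
  (i < n)%N -> upd w n e i = w i.
Proof. by move=> lin; rewrite ffunE -val_eqE /= ltn_eqF. Qed.

Section AdaptedSums.
Variables (R : realType) (T : finType) (K : nat).
Variables (F : 'I_K -> {ffun 'I_K -> T} -> R) (X : nat -> {ffun 'I_K -> T} -> R).
Hypothesis F_ge0 : forall j w, 0 <= F j w.
Hypothesis F_adapted : forall (j : 'I_K) w w', agree j.+1 w w' -> F j w = F j w'.
Hypothesis X_step : forall (n : 'I_K) w,
  \sum_(e : T) F n (upd w n e) * X n.+1 (upd w n e) <= X n w.

(** [F] gives conditional weights and [X] is a supermartingale under them. Induction on the number
    of free coordinates: the first one is fixed by a partition, and its weight, being adapted, comes
    out of the sum over the later ones. *)
Lemma adapted_sum_from (n : nat) (w : {ffun 'I_K -> T}) : (n <= K)%N ->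
  \sum_(w' | agree n w' w) (\prod_(j < K | (n <= j)%N) F j w') * X K w' <= X n w.
Proof.
move=> nK; rewrite -(subKn nK); move: (K - n)%N (leq_subr n K) => m {nK n}.
elim: m w => [|m IHm] w mK.
  rewrite subn0 (big_pred1 w) => [|w'].
    by rewrite big_pred0 ?mul1r// => j; rewrite leqNgt ltn_ord.
  by apply/agreeP/eqP => [h|-> //]; apply/ffunP => i; apply: h; exact: ltn_ord.
have nK : (K - m.+1 < K)%N by rewrite ltn_subrL (leq_trans _ mK).
pose n := Ordinal nK.
have Sn : (K - m = n.+1)%N by rewrite /= subnSK.
rewrite -[(K - m.+1)%N]/(val n).
apply: le_trans (X_step n w).
rewrite (partition_big (fun w' : {ffun 'I_K -> T} => w' n) xpredT) //=.
apply: ler_sum => e _.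
have eqP_ w' : agree n w' w && (w' n == e) = agree n.+1 w' (upd w n e).
  apply/andP/agreeP => [[/agreeP h /eqP <-] i|h].
    rewrite ltnS leq_eqVlt => /predU1P[/val_inj ->|lin]; first by rewrite upd_same.
    by rewrite upd_lt// h.
  split; last by rewrite h// upd_same.
  by apply/agreeP => i lin; rewrite h ?ltnS 1?ltnW// upd_lt.
rewrite (eq_bigl _ _ eqP_).
rewrite (eq_bigr (fun w' => F n (upd w n e) *
  ((\prod_(j < K | (n.+1 <= j)%N) F j w') * X K w'))); last first.
  move=> w' hw'; rewrite (bigD1 n)//= mulrA; congr (_ * _ * _).
    exact: F_adapted.
  by apply: eq_bigl => j; rewrite ltn_neqAle andbC eq_sym.
rewrite -mulr_sumr; apply: ler_wpM2l => //.
by have := IHm (upd w n e) (ltnW mK); rewrite Sn.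
Qed.

Lemma adapted_sum (default_run : {ffun 'I_K -> T}) :
  \sum_w (\prod_(j < K) F j w) * X K w <= X 0 default_run.
Proof.
apply: le_trans (adapted_sum_from 0 default_run (leq0n _)).
rewrite [leRHS](eq_bigl xpredT) // => w'.
by apply/agreeP.
Qed.

End AdaptedSums.

(** * Exponential moments of a single transition *)

Lemma expR_mgf_centered (R : realType) (S : finType) (q V : S -> R) (M l : R) :
  (forall s, 0 <= q s) -> \sum_s q s = 1 -> 0 <= M ->
  (forall s, 0 <= V s <= M) -> `|l| * M <= 2^-1 ->
  \sum_s q s * expR (l * (V s - \sum_t q t * V t) - l ^+ 2 * M ^+ 2) <= 1.
Proof.
move=> q0 q1 M0 VM lM; set mu := \sum_t q t * V t.
have mu0 : 0 <= mu by apply: sumr_ge0 => s _; rewrite mulr_ge0//; have /andP[] := VM s.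
have muM : mu <= M.
  rewrite -[leRHS]mul1r -q1 mulr_suml; apply: ler_sum => s _.
  by rewrite ler_wpM2l//; have /andP[] := VM s.
(* The linear term has mean 0 and the square is at most [l ^+ 2 * M ^+ 2]. *)
have h s : expR (l * (V s - mu)) <= 1 + l * (V s - mu) + l ^+ 2 * M ^+ 2.
  have d : `|V s - mu| <= M by rewrite ler_norml; have := VM s; lra.
  have ld : `|l * (V s - mu)| <= 2^-1.
    by apply: le_trans lM; rewrite normrM ler_wpM2l.
  apply: le_trans (expR_le1DxDxx R _ _) _; first by rewrite -ler_norml.
  rewrite lerD2l exprMn ler_wpM2l ?sqr_ge0// -[leLHS]real_normK ?num_real//.
  by rewrite lerXn2r// nnegrE.
under eq_bigr do rewrite expRB mulrA.
rewrite -mulr_suml ler_pdivrMr ?expR_gt0// mul1r.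
apply: le_trans (expR_ge1Dx _).
apply: le_trans (_ : \sum_s q s * (1 + l * (V s - mu) + l ^+ 2 * M ^+ 2) <= _).
  by apply: ler_sum => s _; rewrite ler_wpM2l.
rewrite (eq_bigr (fun s => q s * (1 - l * mu + l ^+ 2 * M ^+ 2) + l * (q s * V s))).
  by rewrite big_split/= -mulr_suml -mulr_sumr q1 -/mu; lra.
by move=> s _; ring.
Qed.

(** The quadratic bound on [expR l] is applied on [U] only, so the compensator is proportional to
    the mass of [U]; this makes the resulting deviation bound multiplicative. *)
Lemma expR_mgf_indicator (R : realType) (S : finType) (q : S -> R) (U : {set S}) (l : R) :
  (forall s, 0 <= q s) -> \sum_s q s = 1 -> 0 <= l <= 2^-1 ->
  \sum_s q s * expR (l * (s \in U)%:R - l * (1 + l) * \sum_(t in U) q t) <= 1.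
Proof.
move=> q0 q1 l01; set m := \sum_(t in U) q t.
under eq_bigr do rewrite expRB mulrA.
rewrite -mulr_suml ler_pdivrMr ?expR_gt0// mul1r.
apply: le_trans (expR_ge1Dx _).
have el : expR l <= 1 + l + l ^+ 2 by apply: expR_le1DxDxx; lra.
apply: le_trans (_ : \sum_s (q s + (l + l ^+ 2) * (if s \in U then q s else 0)) <= _).
  apply: ler_sum => s _; case: (s \in U); rewrite ?mulr1 ?mulr0 ?expR0; last by lra.
  by have := ler_wpM2l (q0 s) el; lra.
by rewrite big_split/= q1 -mulr_sumr -big_mkcond/= -/m; lra.
Qed.

(** * Exponential moments along a run *)

(** [t i] is the state reached after step [i], so the state at step [n.+1] is read at index [n];
    [s1] is also the value out of range. *)
Definition state_at {S : Type} {H : nat} (s1 : S) (t : {ffun 'I_H -> S}) (n : nat) : S :=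
  if n is n'.+1 then (if insub n' is Some i then t i else s1) else s1.

Lemma state_at_upd_le (S : Type) (H : nat) (s1 : S) (t : {ffun 'I_H -> S}) (n : 'I_H) e m :
  (m <= n)%N -> state_at s1 (upd t n e) m = state_at s1 t m.
Proof.
case: m => [//|m] mn /=; case: insubP => [i _ im|//].
by rewrite upd_lt// im.
Qed.

Lemma state_at_upd_S (S : Type) (H : nat) (s1 : S) (t : {ffun 'I_H -> S}) (n : 'I_H) e :
  state_at s1 (upd t n e) n.+1 = e.
Proof.
rewrite /=; case: insubP => [i _ im|]; last by rewrite ltn_ord.
by rewrite (val_inj im : i = n) upd_same.
Qed.

Lemma agree_state_at (S : eqType) (H : nat) (s1 : S) (t t' : {ffun 'I_H -> S}) n :
  agree n t t' -> state_at s1 t n = state_at s1 t' n.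
Proof.
case: n => [//|n] /agreeP h /=; case: insubP => [i _ im|//].
by rewrite h// im.
Qed.

Lemma agreeW (T : eqType) (K m n : nat) (w w' : {ffun 'I_K -> T}) :
  (m <= n)%N -> agree n w w' -> agree m w w'.
Proof.
by move=> mn /agreeP h; apply/agreeP => i im; apply: h; exact: leq_trans mn.
Qed.

Section Trajectory.
Variables (R : realType) (S A : finType) (H : nat).
Variables (P : S -> A -> S -> R) (s1 : S) (pl : nat -> S -> A).
Hypothesis P_ge0 : forall s a s', 0 <= P s a s'.

Lemma traj_sum_le (phi : nat -> S -> A -> S -> R) (X : nat -> {ffun 'I_H -> S} -> R)
    (t0 : {ffun 'I_H -> S}) :
  (forall n s a s', 0 <= phi n s a s') ->
  (forall (n : 'I_H) t, let s := state_at s1 t n in let a := pl n s in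
     \sum_e P s a e * phi n s a e * X n.+1 (upd t n e) <= X n t) ->
  \sum_t (\prod_(h < H) (P (state_at s1 t h) (pl h (state_at s1 t h)) (t h) *
                         phi h (state_at s1 t h) (pl h (state_at s1 t h)) (t h))) * X H t
    <= X 0 t0.
Proof.
move=> phi0 step.
apply: (@adapted_sum R S H (fun (h : 'I_H) t =>
   P (state_at s1 t h) (pl h (state_at s1 t h)) (t h) *
   phi h (state_at s1 t h) (pl h (state_at s1 t h)) (t h))).
- by move=> j w; rewrite mulr_ge0.
- move=> j w w' ww'; rewrite (agree_state_at _ _ s1 _ _ _ (agreeW _ _ _ _ _ _ (leqnSn j) ww')).
  by move/agreeP: ww' => ->.
- move=> n w; apply: le_trans (step n w) => /=.
  by under eq_bigr do rewrite state_at_upd_le// upd_same.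
Qed.

Hypothesis P_sum1 : forall s a, \sum_(s' : S) P s a s' = 1.

Definition trajw (t : {ffun 'I_H -> S}) : R :=
  \prod_(h < H) P (state_at s1 t h) (pl h (state_at s1 t h)) (t h).

Lemma trajw_ge0 t : 0 <= trajw t.
Proof. exact: prodr_ge0. Qed.

Lemma trajw_sum_le (X : nat -> {ffun 'I_H -> S} -> R) (t0 : {ffun 'I_H -> S}) :
  (forall (n : 'I_H) t, let s := state_at s1 t n in let a := pl n s in
     \sum_e P s a e * X n.+1 (upd t n e) <= X n t) ->
  \sum_t trajw t * X H t <= X 0 t0.
Proof.
move=> step; apply: le_trans (traj_sum_le (fun _ _ _ _ => 1) X t0 _ _) => //.
  by rewrite le_eqVlt; apply/predU1P; left; apply: eq_bigr => t _;
    congr (_ * _); apply: eq_bigr => h _; rewrite mulr1.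
by move=> n t /=; under eq_bigr do rewrite mulr1; exact: step.
Qed.

Lemma trajw_sum1 (t0 : {ffun 'I_H -> S}) : \sum_t trajw t = 1.
Proof.
apply/eqP; rewrite eq_le; apply/andP; split.
  under eq_bigr do rewrite -[trajw _]mulr1.
  apply: (trajw_sum_le (fun _ _ => 1) t0) => n t /=.
  by under eq_bigr do rewrite mulr1; rewrite P_sum1.
(* The reverse inequality is the supermartingale bound for the constant -1. *)
rewrite -lerN2 -sumrN; under eq_bigr do rewrite -mulrN1.
apply: (trajw_sum_le (fun _ _ => -1) t0) => n t /=.
by under eq_bigr do rewrite mulrN1; rewrite sumrN P_sum1.
Qed.

End Trajectory.

(** * Clipped values and capped trajectory costs *)

Section TruncatedValue.
Variables (R : realType) (S A : finType) (H : nat).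
Variables (P : S -> A -> S -> R) (s1 : S) (plm : nat -> S -> A).
Hypothesis P_ge0 : forall s a s', 0 <= P s a s'.
Hypothesis P_sum1 : forall s a, \sum_(s' : S) P s a s' = 1.
Variables (g : S -> A -> R) (gam M : R).
Hypothesis g_ge0 : forall s a, 0 <= g s a.
Hypothesis gam_ge0 : 0 <= gam.
Hypothesis M_ge0 : 0 <= M.

(** Cost-to-go with expansion factor [gam] per step, clipped at [M] at every step; [plm] is indexed
    by the number of remaining steps, as the Q functions are. *)
Fixpoint clipval (m : nat) : S -> R :=
  if m is m'.+1 then fun s => let a := plm m'.+1 s in
    Num.min M (g s a + gam * \sum_s' P s a s' * clipval m' s')
  else fun _ => 0.

Lemma clipval_itv m s : 0 <= clipval m s <= M.
Proof.
elim: m s => [|m IHm] s /=; first by rewrite lexx.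
rewrite ge_min lexx /= andbT le_min M_ge0 /= addr_ge0// mulr_ge0// sumr_ge0// => s' _.
by rewrite mulr_ge0//; have /andP[] := IHm s'.
Qed.

Let pl (n : nat) : S -> A := plm (H - n).

Definition tcost (n : nat) (t : {ffun 'I_H -> S}) : R :=
  \sum_(i < H | (i < n)%N) gam ^+ i * g (state_at s1 t i) (pl i (state_at s1 t i)).

Lemma tcost_ge0 n t : 0 <= tcost n t.
Proof. by apply: sumr_ge0 => i _; rewrite mulr_ge0// exprn_ge0. Qed.

Lemma tcost_upd (n : 'I_H) t e : tcost n.+1 (upd t n e) =
  tcost n t + gam ^+ n * g (state_at s1 t n) (pl n (state_at s1 t n)).
Proof.
rewrite /tcost (bigD1 n)//= addrC state_at_upd_le//; congr (_ + _).
rewrite (eq_bigl (fun i : 'I_H => (i < n)%N)); last first.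
  by move=> i; rewrite ltnS ltn_neqAle andbC.
by apply: eq_bigr => i lin; rewrite state_at_upd_le// ltnW.
Qed.

Variables (B C : R).
Hypothesis C_ge0 : 0 <= C.
Hypothesis BC : forall n, (n <= H)%N -> C + gam ^+ n * M <= B.

Definition cap (y : R) : R := if y < C then y else B.

(* Once the accumulated cost reaches [C] the capped total is [B], which pays for
   the at most [gam ^+ n * M] that [clipval] still promises; below [C] the
   recursion of [clipval] is an expectation. *)
Lemma clipval_le_cap (t0 : {ffun 'I_H -> S}) :
  clipval H s1 <= \sum_t trajw R S A H P s1 pl t * cap (tcost H t).
Proof.
(* The sign turns a submartingale into the supermartingale required; once the cost reaches [C] the
   process stays at [-B]. *)
pose X n (t : {ffun 'I_H -> S}) := - (if tcost n t < C
  then tcost n t + gam ^+ n * clipval (H - n) (state_at s1 t n) else B).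
have X0 : X 0 t0 = - (if 0 < C then clipval H s1 else B).
  by rewrite /X /tcost big_pred0// add0r expr0 mul1r subn0.
have tB n t : (n <= H)%N -> tcost n t < C ->
    tcost n t + gam ^+ n * clipval (H - n) (state_at s1 t n) <= B.
  move=> nH tC; apply: le_trans (BC n nH); rewrite lerD ?(ltW tC)//.
  by rewrite ler_wpM2l ?exprn_ge0//; have /andP[] := clipval_itv (H - n) (state_at s1 t n).
apply: le_trans (_ : - X 0 t0 <= _).
  rewrite X0 opprK; case: ifP => // _; apply: le_trans (BC 0 _) => //.
  by rewrite expr0 mul1r -[leLHS]add0r lerD//; have /andP[] := clipval_itv H s1.
have XH t : X H t = - cap (tcost H t).
  by rewrite /X /cap subnn mulr0 addr0.
under eq_bigr do rewrite -[cap _]opprK -XH mulrN.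
rewrite sumrN lerN2; apply: trajw_sum_le => // n t /=.
under eq_bigr do rewrite /X tcost_upd state_at_upd_S.
rewrite /X; set s := state_at s1 t n; set a := pl n s; set x := tcost n t.
have gn0 : 0 <= gam ^+ n * g s a by rewrite mulr_ge0// exprn_ge0.
have HnE : (H - n = (H - n.+1).+1)%N by rewrite subnSK.
have [xC|xC] := ltP x C; last first.
  have -> : x + gam ^+ n * g s a < C = false by apply/negbTE; rewrite -leNgt; lra.
  by rewrite -mulr_suml P_sum1 mul1r.
have [xgC|xgC] := ltP (x + gam ^+ n * g s a) C; last first.
  rewrite -mulr_suml P_sum1 mul1r lerN2; apply: tB => //; exact: ltnW.
under eq_bigr do rewrite mulrN mulrDr.
rewrite sumrN lerN2 big_split/= -mulr_suml P_sum1 mul1r -addrA lerD2l.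
rewrite HnE /= -HnE -/(pl n s) -/a.
under [X in _ <= _ + X]eq_bigr do rewrite mulrCA.
rewrite -mulr_sumr exprSr -mulrA -mulrDr ler_wpM2l ?exprn_ge0//.
by rewrite ge_min lexx orbT.
Qed.

Lemma cap_itv (y : R) : 0 <= y -> 0 <= cap y <= B.
Proof.
move=> y0; have := BC 0 (leq0n _); rewrite expr0 mul1r /cap.
by have := M_ge0; have := C_ge0; have [yC|yC] := ltP y C => h; lra.
Qed.

(** The capped cost [z] satisfies [z ^+ 2 <= B * z], so the mean of [expR (- (l * z))] is at most 1
    minus [l * (1 - l * B / 2)] times the mean of [z]. As [l * B <= 2], that mean can be lowered to
    the clipped value, itself at most [M]. A whole episode thus has variance proxy [B * M], whatever
    its length. *)
Lemma traj_mgf (l : R) (t0 : {ffun 'I_H -> S}) : 0 <= l -> l * B <= 2 ->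
  \sum_t trajw R S A H P s1 pl t *
    expR (l * clipval H s1 - l * cap (tcost H t) - l ^+ 2 * B * M / 2) <= 1.
Proof.
move=> l0 lB; set D := clipval H s1; set tw := trajw _ _ _ _ _ _ _.
have tw0 t : 0 <= tw t by exact: trajw_ge0.
have [D0 DM] : 0 <= D /\ D <= M by apply/andP; exact: clipval_itv.
have B0 : 0 <= B by have := cap_itv C C_ge0; rewrite /cap ltxx; lra.
pose Z := \sum_t tw t * cap (tcost H t).
have DZ : D <= Z by exact: clipval_le_cap.
rewrite (eq_bigr (fun t => expR (l * D - l ^+ 2 * B * M / 2) *
   (tw t * expR (- (l * cap (tcost H t)))))); last first.
  by move=> t _; rewrite mulrCA -expRD; congr (_ * expR _); ring.
rewrite -mulr_sumr -ler_pdivlMl ?expR_gt0// mulr1 -expRN.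
apply: le_trans (expR_ge1Dx _).
apply: le_trans (_ : 1 - l * (1 - l * B / 2) * Z <= _); last first.
  have h : l * (1 - l * B / 2) * D <= l * (1 - l * B / 2) * Z.
    by rewrite ler_wpM2l// mulr_ge0//; lra.
  have : l ^+ 2 * B * D <= l ^+ 2 * B * M by rewrite ler_wpM2l// mulr_ge0// sqr_ge0.
  by move: h; nra.
rewrite -[X in _ <= X - _](trajw_sum1 R S A H P s1 pl P_ge0 P_sum1 t0) -/tw /Z mulr_sumr -sumrB.
apply: ler_sum => t _; set z := cap _.
have [z0 zB] : 0 <= z /\ z <= B by apply/andP/cap_itv/tcost_ge0.
rewrite mulrCA -[X in _ <= X - _]mulr1 -mulrBr ler_wpM2l//.
apply: le_trans (expRN_le1BxDxx2 R _ (mulr_ge0 l0 z0)) _.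
have : l ^+ 2 * z * z <= l ^+ 2 * B * z by rewrite ler_wpM2r// ler_wpM2l// sqr_ge0.
lra.
Qed.

End TruncatedValue.

(** * The law of a run: adaptedness and integration over one episode *)

Section Model.
Variables (R : realType) (S A : finType) (H K N : nat).
Variables (P : S -> A -> S -> R) (r : S -> A -> R) (init : 'I_K -> S) (p : R).
Variable pick : (A -> R) -> A.
Hypothesis P_ge0 : forall s a s', 0 <= P s a s'.
Hypothesis P_sum1 : forall s a, \sum_(s' : S) P s a s' = 1.

Local Notation Run := (Om S A H K N).
Local Notation hist := (cHk r init p pick).
Implicit Types (w : Run) (jo : 'I_K).

Definition policy_of w (jo : 'I_K) (m : nat) (s : S) : A :=
  pick (Qk r p pick w jo (hist w jo) m s).

Lemma curE w jo h : cur init w jo h = state_at (init jo) (w jo).2 h.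
Proof. by []. Qed.

Lemma actE w jo h : act r init p pick w jo (hist w jo) h =
  policy_of w jo (H - h) (state_at (init jo) (w jo).2 h).
Proof. by []. Qed.

Lemma eq_extCount w w' jo : agree jo w w' -> (w jo).1 = (w' jo).1 ->
  extCount w jo = extCount w' jo.
Proof.
move=> /agreeP ww' e; apply/funext => s; apply/funext => a; apply/funext => s'.
apply: eq_bigr => j; rewrite leq_eqVlt => /predU1P[/val_inj ->|/ww' ->//].
by rewrite e.
Qed.

Lemma eq_ownCounts w w' n : (n <= K)%N -> agree n w w' ->
  ownCounts r init p pick w n = ownCounts r init p pick w' n.
Proof.
elim: n => [//|n IHn] nK ww' /=.
rewrite (IHn (ltnW nK) (agreeW _ _ _ _ _ _ (leqnSn n) ww')).
apply/funext => s; apply/funext => a; apply/funext => s'; congr (_ + _)%N.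
case: insubP => [jo _ jn|//].
have wj : w jo = w' jo by move/agreeP: ww'; apply; rewrite jn.
have aw : agree jo w w' by rewrite jn; exact: agreeW ww'.
by rewrite /epCount /act /Qk /Phat (eq_extCount _ _ _ aw) ?wj// /cur wj.
Qed.

Lemma eq_hist w w' jo : agree jo w w' -> hist w jo = hist w' jo.
Proof. by move=> aw; apply: eq_ownCounts => //; exact: ltnW. Qed.

(** The oracle draws of an episode precede its planning, so its policy depends on the earlier
    episodes and on these draws, but not on its own trajectory. *)
Lemma eq_policy_of w w' jo : agree jo w w' -> (w jo).1 = (w' jo).1 ->
  policy_of w jo = policy_of w' jo.
Proof.
move=> aw e; apply/funext => m; apply/funext => s.
by rewrite /policy_of /Qk /Phat (eq_hist _ _ _ aw) (eq_extCount _ _ _ aw e).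
Qed.

Lemma agree_upd (T : eqType) (w : {ffun 'I_K -> T}) (jo : 'I_K) e :
  agree jo (upd w jo e) w.
Proof. by apply/agreeP => i ij; rewrite upd_lt. Qed.

Lemma agree_upd2 (T : eqType) (w : {ffun 'I_K -> T}) (jo : 'I_K) e e' :
  agree jo (upd w jo e) (upd w jo e').
Proof. by apply/agreeP => i ij; rewrite !upd_lt. Qed.

Lemma ownCountsE w n s a s' : (n <= K)%N ->
  ownCounts r init p pick w n s a s' =
  (\sum_(j < K | (j < n)%N) epCount r init p pick w j (hist w j) s a s')%N.
Proof.
elim: n => [|n IHn] nK /=; first by rewrite big_pred0.
rewrite IHn 1?ltnW//.
case: insubP => [jo _ jn|]; last by rewrite nK.
rewrite [RHS](bigD1 jo) /=; last by rewrite jn.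
rewrite addnC -jn; congr (_ + _)%N; apply: eq_bigl => j.
by rewrite ltn_neqAle ltnS andbC -val_eqE.
Qed.

Definition ep_weight w (jo : 'I_K) : R :=
  (\prod_(x : S * A * 'I_N) P x.1.1 x.1.2 ((w jo).1 x)) *
  \prod_(h < H) P (cur init w jo h) (act r init p pick w jo (hist w jo) h) ((w jo).2 h).

(* Exponentials of sums over the observed transitions factor over the episodes;
   [phix] and [phit] are the factors of an oracle sample and of a step of the
   trajectory. *)
Definition tilted_weight (phix : S -> A -> S -> R) (phit : S -> A -> S -> R) w (jo : 'I_K) : R :=
  (\prod_(x : S * A * 'I_N) (P x.1.1 x.1.2 ((w jo).1 x) * phix x.1.1 x.1.2 ((w jo).1 x))) *
  \prod_(h < H) (P (cur init w jo h) (act r init p pick w jo (hist w jo) h) ((w jo).2 h)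
    * phit (cur init w jo h) (act r init p pick w jo (hist w jo) h) ((w jo).2 h)).

Lemma ep_weight_ge0 w jo : 0 <= ep_weight w jo.
Proof. by rewrite mulr_ge0// prodr_ge0. Qed.

Lemma ep_weight_adapted (jo : 'I_K) w w' : agree jo.+1 w w' -> ep_weight w jo = ep_weight w' jo.
Proof.
move=> aw; have aw' := agreeW _ _ _ _ _ _ (leqnSn _) aw.
have wj : w jo = w' jo by move/agreeP: aw; apply.
rewrite /ep_weight wj; congr (_ * _); apply: eq_bigr => h _.
by rewrite !actE (eq_policy_of _ _ _ aw') wj// !curE wj.
Qed.

(** The trajectory is integrated first, with the draws fixed, at the price [c]; then independence of
    the draws turns the sum of products into a product of sums. *)
Lemma episode_sum_le (phix : S -> A -> S -> R) (G : Run -> R) w jo (c : R) :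
  (forall s a s', 0 <= phix s a s') ->
  (forall x, \sum_t G (upd w jo (x, t)) <= c) ->
  \sum_e (\prod_(x : S * A * 'I_N)
     (P x.1.1 x.1.2 ((upd w jo e jo).1 x) * phix x.1.1 x.1.2 ((upd w jo e jo).1 x)))
     * G (upd w jo e)
  <= (\prod_(x : S * A * 'I_N) \sum_s' P x.1.1 x.1.2 s' * phix x.1.1 x.1.2 s') * c.
Proof.
move=> phi0 Gc; rewrite bigA_distr_bigA /= mulr_suml.
pose Q (x : {ffun S * A * 'I_N -> S}) := \prod_(y : S * A * 'I_N)
  (P y.1.1 y.1.2 (x y) * phix y.1.1 y.1.2 (x y)).
rewrite (eq_bigr (fun e => Q e.1 * G (upd w jo (e.1, e.2)))); last first.
  by case=> x t _; rewrite upd_same.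
rewrite -(pair_bigA _ (fun x t => Q x * G (upd w jo (x, t)))) /=.
apply: ler_sum => x _; rewrite -mulr_sumr ler_wpM2l// prodr_ge0// => y _.
by rewrite mulr_ge0.
Qed.

(** On the right [t'] is arbitrary, which makes the policy constant in a sum over [t]. *)
Lemma act_upd w jo x t t' h :
  act r init p pick (upd w jo (x, t)) jo (hist (upd w jo (x, t)) jo) h =
  policy_of (upd w jo (x, t')) jo (H - h) (state_at (init jo) t h).
Proof.
rewrite actE upd_same /=; congr (_ _ _); apply: eq_policy_of; first exact: agree_upd2.
by rewrite !upd_same.
Qed.

Lemma cur_upd w jo x t h : cur init (upd w jo (x, t)) jo h = state_at (init jo) t h.
Proof. by rewrite curE upd_same. Qed.

Lemma ep_weight_sum_le (Phi : Run -> R) w jo (c : R) :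
  (forall x t', \sum_t trajw R S A H P (init jo)
       (fun n => policy_of (upd w jo (x, t')) jo (H - n)) t * Phi (upd w jo (x, t)) <= c) ->
  \sum_e ep_weight (upd w jo e) jo * Phi (upd w jo e) <= c.
Proof.
move=> hc; pose t' := (w jo).2.
pose G (u : Run) := (\prod_(h < H) P (cur init u jo h)
  (act r init p pick u jo (hist u jo) h) ((u jo).2 h)) * Phi u.
have := episode_sum_le (fun _ _ _ => 1) G w jo c.
rewrite [X in _ -> _ -> _ <= X * _]big1 ?mul1r; last first.
  by move=> x _; under eq_bigr do rewrite mulr1; exact: P_sum1.
move=> h; apply: le_trans (h _ _) => //.
  rewrite le_eqVlt; apply/predU1P; left; apply: eq_bigr => e _.
  rewrite /ep_weight /G mulrA; congr (_ * _ * _).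
  by apply: eq_bigr => x _; rewrite mulr1.
move=> x; apply: le_trans (hc x t').
rewrite le_eqVlt; apply/predU1P; left; apply: eq_bigr => t _.
rewrite /G; congr (_ * _); apply: eq_bigr => h' _.
by rewrite cur_upd (act_upd w jo x t t') upd_same.
Qed.

Lemma ep_weight_sum1 w jo : \sum_e ep_weight (upd w jo e) jo = 1.
Proof.
apply/eqP; rewrite eq_le; apply/andP; split.
  under eq_bigr do rewrite -[ep_weight _ _]mulr1.
  apply: (ep_weight_sum_le (fun _ => 1)) => x t'.
  by under eq_bigr do rewrite mulr1; rewrite trajw_sum1.
rewrite -lerN2 -sumrN; under eq_bigr do rewrite -mulrN1.
apply: (ep_weight_sum_le (fun _ => -1)) => x t'.
by under eq_bigr do rewrite mulrN1; rewrite sumrN trajw_sum1.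
Qed.

Lemma tilted_weight_sum_le1 (phix phit : S -> A -> S -> R) w jo :
  (forall s a s', 0 <= phix s a s') -> (forall s a s', 0 <= phit s a s') ->
  (forall s a, \sum_s' P s a s' * phix s a s' <= 1) ->
  (forall s a, \sum_s' P s a s' * phit s a s' <= 1) ->
  \sum_e tilted_weight phix phit (upd w jo e) jo <= 1.
Proof.
move=> x0 t0 x1 t1; pose t' := (w jo).2.
pose G (u : Run) := \prod_(h < H) (P (cur init u jo h)
    (act r init p pick u jo (hist u jo) h) ((u jo).2 h) *
  phit (cur init u jo h) (act r init p pick u jo (hist u jo) h) ((u jo).2 h)).
apply: le_trans (episode_sum_le phix G w jo 1 x0 _) _ => [x|]; last first.
  rewrite mulr1; apply: prodr_ile1 => x _; rewrite x1 andbT sumr_ge0// => s' _.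
  by rewrite mulr_ge0.
have := traj_sum_le R S A H P (init jo) (fun n => policy_of (upd w jo (x, t')) jo (H - n)) P_ge0
  (fun _ => phit) (fun _ _ => 1) t'.
move=> h; apply: le_trans (h _ _) => //; last first.
  by move=> n t /=; under eq_bigr do rewrite mulr1; exact: t1.
rewrite le_eqVlt; apply/predU1P; left; apply: eq_bigr => t _.
rewrite /G mulr1; apply: eq_bigr => h' _.
by rewrite cur_upd (act_upd w jo x t t') upd_same.
Qed.

Definition default_run : Run := [ffun jo => ([ffun=> init jo], [ffun=> init jo])].

Lemma run_sum_le1 (F : 'I_K -> Run -> R) :
  (forall j w, 0 <= F j w) ->
  (forall (j : 'I_K) w w', agree j.+1 w w' -> F j w = F j w') ->
  (forall j w, \sum_e F j (upd w j e) <= 1) ->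
  \sum_w \prod_(j < K) F j w <= 1.
Proof.
move=> F0 Fa F1; under eq_bigr do rewrite -[\prod_(_ | _) _]mulr1.
apply: (adapted_sum R _ K F (fun _ _ => 1) F0 Fa _ default_run) => j w.
by under eq_bigr do rewrite mulr1; exact: F1.
Qed.

Lemma massE w : mass P r init p pick w = \prod_(j < K) ep_weight w j.
Proof. by []. Qed.

Lemma mass_ge0 w : 0 <= mass P r init p pick w.
Proof. by rewrite massE prodr_ge0// => j _; exact: ep_weight_ge0. Qed.

Lemma mass_sum1 : \sum_(w : Run) mass P r init p pick w = 1.
Proof.
apply/eqP; rewrite eq_le; apply/andP; split.
  apply: run_sum_le1 => [j w|j w w'|j w]; [exact: ep_weight_ge0|exact: ep_weight_adapted|].
  by rewrite ep_weight_sum1.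
rewrite -lerN2 -sumrN; under eq_bigr do rewrite massE -mulrN1.
apply: (adapted_sum R _ K (fun j w => ep_weight w j) (fun _ _ => -1) _ _ _ default_run).
- by move=> j w; exact: ep_weight_ge0.
- by move=> j w w'; exact: ep_weight_adapted.
- by move=> j w; under eq_bigr do rewrite mulrN1; rewrite sumrN ep_weight_sum1.
Qed.

Lemma tilted_weight_adapted (phix phit : S -> A -> S -> R) jo w w' :
  agree jo.+1 w w' -> tilted_weight phix phit w jo = tilted_weight phix phit w' jo.
Proof.
move=> aw; have aw' := agreeW _ _ _ _ _ _ (leqnSn _) aw.
have wj : w jo = w' jo by move/agreeP: aw; apply.
rewrite /tilted_weight wj; congr (_ * _); apply: eq_bigr => h _.
by rewrite !actE (eq_policy_of _ _ _ aw') wj// !curE wj.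
Qed.

Lemma sum_count_ext (f : S -> R) w jo s0 a0 :
  \sum_s' (extCount w jo s0 a0 s')%:R * f s' =
  \sum_(j < K | (j <= jo)%N) \sum_(i < N) f ((w j).1 (s0, a0, i)).
Proof.
under eq_bigr do rewrite natr_sum mulr_suml.
rewrite exchange_big /=; apply: eq_bigr => j _.
under eq_bigr do rewrite natr_sum mulr_suml.
rewrite exchange_big /=; apply: eq_bigr => i _.
rewrite (bigD1 ((w j).1 (s0, a0, i))) //= eqxx mul1r big1 ?addr0// => s'.
by rewrite eq_sym => /negbTE ->; rewrite mul0r.
Qed.

Lemma sum_count_own (f : S -> R) w (n : nat) s0 a0 : (n <= K)%N ->
  \sum_s' (ownCounts r init p pick w n s0 a0 s')%:R * f s' =
  \sum_(j < K | (j < n)%N) \sum_(h < H)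
    (if (cur init w j h, act r init p pick w j (hist w j) h) == (s0, a0)
     then f ((w j).2 h) else 0).
Proof.
move=> nK.
under eq_bigr do rewrite ownCountsE// natr_sum mulr_suml.
rewrite exchange_big /=; apply: eq_bigr => j _.
under eq_bigr do rewrite natr_sum mulr_suml.
rewrite exchange_big /=; apply: eq_bigr => h _.
rewrite (bigD1 ((w j).2 h)) //= !xpair_eqE eqxx andbT big1 ?addr0 => [|s'].
  by case: ifP; rewrite ?mul1r ?mul0r.
by rewrite !xpair_eqE eq_sym => /negbTE ->; rewrite andbF mul0r.
Qed.

(** Each observation of [(s0, a0)] contributes a factor of conditional mean at most 1, every other
    transition the factor 1. The number of visits may therefore be random and depend on the past. *)
Lemma sample_mgf (f : S -> R) jo s0 a0 :
  \sum_s' P s0 a0 s' * expR (f s') <= 1 ->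
  \sum_(w : Run) mass P r init p pick w *
    expR (\sum_s' (hist w jo s0 a0 s' + extCount w jo s0 a0 s')%:R * f s') <= 1.
Proof.
move=> f1.
(* [b] tells whether a transition belongs to the data of episode [jo]: oracle draws do up to [jo]
   inclusive, own transitions only before it. *)
pose ph (b : bool) s a s' := expR (if b && ((s, a) == (s0, a0)) then f s' else 0).
pose F (j : 'I_K) w := tilted_weight (ph (j <= jo)%N) (ph (j < jo)%N) w j.
have ph1 b s a : \sum_s' P s a s' * ph b s a s' <= 1.
  rewrite /ph; case: b => /=; last by under eq_bigr do rewrite expR0 mulr1; rewrite P_sum1.
  by case: eqP => [[-> ->]//|_]; under eq_bigr do rewrite expR0 mulr1; rewrite P_sum1.
have ph0 b s a s' : 0 <= ph b s a s' by exact: expR_ge0.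
have F1 : \sum_w \prod_(j < K) F j w <= 1.
  apply: run_sum_le1 => [j w|j w w'|j w];
    [|exact: tilted_weight_adapted|exact: tilted_weight_sum_le1].
  by rewrite mulr_ge0// prodr_ge0// => ? _; rewrite mulr_ge0.
apply: le_trans F1.
rewrite le_eqVlt; apply/predU1P; left; apply: eq_bigr => w _.
under [X in expR X]eq_bigr do rewrite natrD mulrDl.
rewrite big_split /= sum_count_own ?(ltnW (ltn_ord jo))// sum_count_ext.
rewrite [X in expR (X + _)]big_mkcond [X in expR (_ + X)]big_mkcond -big_split expR_sum.
rewrite massE -big_split /=; apply: eq_bigr => j _.
rewrite /F /tilted_weight /ep_weight !big_split /= -!mulrA; congr (_ * _).
rewrite mulrCA; congr (_ * _).
rewrite expRD mulrC; congr (_ * _).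
  case: (leqP j jo) => _; last by rewrite expR0 big1// => x _; rewrite /ph expR0.
  rewrite expR_sum; transitivity (\prod_(sa : S * A) \prod_(i < N)
    ph true sa.1 sa.2 ((w j).1 (sa, i))); last first.
    by rewrite pair_bigA /=; apply: eq_bigr => -[sa i] _.
  rewrite (bigD1 (s0, a0))//= [X in _ = _ * X]big1 ?mulr1 => [|sa /negbTE hsa].
    by apply: eq_bigr => i _; rewrite /ph eqxx.
  by apply: big1 => i _; rewrite /ph -surjective_pairing hsa expR0.
case: (ltnP j jo) => _; last by rewrite expR0 big1// => x _; rewrite /ph expR0.
by rewrite expR_sum; apply: eq_bigr => h _.
Qed.

End Model.

(** * Optimism *)

Section Planning.
Variables (R : realType) (S A : finType) (H : nat).
Variables (P : S -> A -> S -> R) (r : S -> A -> R) (pick : (A -> R) -> A).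
Hypothesis P_ge0 : forall s a s', 0 <= P s a s'.
Hypothesis P_sum1 : forall s a, \sum_(s' : S) P s a s' = 1.
Hypothesis r01 : forall s a, 0 <= r s a <= 1.
Hypothesis pick_max : forall (f : A -> R) (a : A), f a <= f (pick f).

Lemma expect_itv (q : S -> R) (f : S -> R) (x y : R) :
  (forall s, 0 <= q s) -> \sum_s q s = 1 -> (forall s, x <= f s <= y) ->
  x <= \sum_s q s * f s <= y.
Proof.
move=> q0 q1 fxy; rewrite -[x]mul1r -[y]mul1r -q1 !mulr_suml.
by apply/andP; split; apply: ler_sum => s _; rewrite ler_wpM2l//; have /andP[] := fxy s.
Qed.

Lemma Qstar_itv m s a : 0 <= Qstar P r pick m s a <= m%:R.
Proof.
elim: m s a => [|m IHm] s a /=; first by rewrite lexx.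
have Vm s' : 0 <= Defs.maxA pick (Qstar P r pick m s') <= m%:R by exact: IHm.
have := expect_itv _ _ _ _ (P_ge0 s a) (P_sum1 s a) Vm.
have := r01 s a; rewrite -natr1; set x := \sum_s' _; lra.
Qed.

Lemma Vstar_itv m s : 0 <= Vstar P r pick m s <= m%:R.
Proof. exact: Qstar_itv. Qed.

Lemma Vpol_itv Q m s : 0 <= Vpol P r pick Q m s <= Vstar P r pick m s.
Proof.
elim: m s => [|m IHm] s /=; first by rewrite /Vstar /Defs.maxA /= lexx.
set a := pick (Q m.+1 s).
have r0 : 0 <= r s a by have /andP[] := r01 s a.
rewrite addr_ge0//=; last first.
  by apply: sumr_ge0 => s' _; rewrite mulr_ge0//; have /andP[] := IHm s'.
apply: le_trans (pick_max (Qstar P r pick m.+1 s) a).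
rewrite /= lerD2l; apply: ler_sum => s' _; rewrite ler_wpM2l//.
by have /andP[] := IHm s'.
Qed.

Variables (Ph : S -> A -> S -> R) (b c e : S -> A -> R) (l : R).
Hypothesis Ph_ge0 : forall s a s', 0 <= Ph s a s'.
Hypothesis l_ge0 : 0 <= l.
Hypothesis c_le_b : forall s a, c s a <= b s a.
Hypothesis Vstar_dev : forall m s a, (m < H)%N ->
  `|\sum_s' Ph s a s' * Vstar P r pick m s' - \sum_s' P s a s' * Vstar P r pick m s'| <= c s a.
Hypothesis set_dev : forall s a (T : {set S}),
  \sum_(s' in T) Ph s a s' <= (1 + l) * \sum_(s' in T) P s a s' + e s a.

Let Q := Qhat H r pick Ph b.
Let Vhat m s := Defs.maxA pick (Q m s).

(** By induction [Vhat] dominates V*, and averaging under [Ph] is monotone; so the bonus only has to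
    cover the error of [Ph] on the fixed function V*. *)
Lemma Qstar_le_Qhat m s a : (m <= H)%N -> Qstar P r pick m s a <= Q m s a.
Proof.
elim: m s a => [|m IHm] s a mH //; rewrite /Q /= -/Q le_min; apply/andP; split.
  have /andP[_ h] := Qstar_itv m.+1 s a.
  by apply: le_trans h _; rewrite ler_nat.
have VV s' : Vstar P r pick m s' <= Vhat m s'.
  by apply: le_trans (IHm s' _ (ltnW mH)) (pick_max _ _).
have h1 : \sum_s' Ph s a s' * Vstar P r pick m s' <= \sum_s' Ph s a s' * Vhat m s'.
  by apply: ler_sum => s' _; rewrite ler_wpM2l.
have := Vstar_dev m s a mH; rewrite ler_norml => /andP[h2 _].
have := c_le_b s a; rewrite -/Q -/(Vhat m) /Vstar in h1 h2 *.
rewrite /Vhat in h1; lra.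
Qed.

Lemma Vstar_le_Vhat m s : (m <= H)%N -> Vstar P r pick m s <= Vhat m s.
Proof. by move=> mH; apply: le_trans (Qstar_le_Qhat m s _ mH) (pick_max _ _). Qed.

Lemma Vhat_le m s : Vhat m s <= H%:R.
Proof. by rewrite /Vhat /Defs.maxA /Q; case: m => [|m] /=; rewrite ?ler0n// ge_min lexx. Qed.

Lemma mass_transfer (D : S -> R) s a : (forall s', 0 <= D s' <= H%:R) ->
  \sum_s' Ph s a s' * D s' <= (1 + l) * \sum_s' P s a s' * D s' + H%:R * e s a.
Proof.
move=> D01; pose x s' := Ph s a s' - (1 + l) * P s a s'.
(* This set depends on the data, hence the uniformity over sets in [set_dev]. On it [D] is at most
   [H]; off it the summands are nonpositive. *)
pose T := [set s' | 0 <= x s'].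
rewrite -lerBlDl mulr_sumr -sumrB.
have h : \sum_(s' in T) x s' <= e s a.
  by rewrite sumrB -mulr_sumr lerBlDl set_dev.
apply: le_trans (_ : H%:R * \sum_(s' in T) x s' <= _); last by rewrite ler_wpM2l.
rewrite mulr_sumr [leRHS]big_mkcond /=; apply: ler_sum => s' _.
rewrite mulrA -mulrBl -/(x s') inE; have /andP[D0 DH] := D01 s'.
case: ifPn => [x0|]; first by rewrite mulrC ler_wpM2r.
by rewrite -ltNge => x0; rewrite mulr_le0_ge0// ltW.
Qed.

Lemma Vhat_sub_Vpol_le m s : (m <= H)%N ->
  Vhat m s - Vpol P r pick Q m s <=
  clipval R S A P (fun m s => pick (Q m s)) (fun s a => b s a + c s a + H%:R * e s a)
    (1 + l) H%:R m s.
Proof.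
elim: m s => [|m IHm] s mH; first by rewrite /Vhat /Defs.maxA /Q /= subrr.
have /andP[Vp0 _] := Vpol_itv Q m.+1 s.
rewrite le_min; apply/andP; split; first by have := Vhat_le m.+1 s; lra.
rewrite /Vhat /Defs.maxA; set a := pick (Q m.+1 s).
have Qa : Q m.+1 s a <= r s a + \sum_s' Ph s a s' * Vhat m s' + b s a.
  by rewrite /Q /= ge_min lexx orbT.
have -> : Vpol P r pick Q m.+1 s = r s a + \sum_s' P s a s' * Vpol P r pick Q m s' by [].
have mH' := ltnW mH.
have D01 s' : 0 <= Vhat m s' - Vstar P r pick m s' <= H%:R.
  have := Vstar_le_Vhat m s' mH'; have := Vhat_le m s'; have := Vstar_itv m s'; lra.
have h1 := mass_transfer _ s a D01.
have := Vstar_dev m s a mH; rewrite ler_norml => /andP[_ h2].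
have sub (q f f' : S -> R) : \sum_s' q s' * (f s' - f' s') =
    \sum_s' q s' * f s' - \sum_s' q s' * f' s'.
  by rewrite -sumrB; apply: eq_bigr => s' _; rewrite mulrBr.
rewrite !sub in h1.
have h3 : \sum_s' P s a s' * Vpol P r pick Q m s' <= \sum_s' P s a s' * Vstar P r pick m s'.
  by apply: ler_sum => s' _; rewrite ler_wpM2l//; have /andP[] := Vpol_itv Q m s'.
have h4 : \sum_s' P s a s' * Vhat m s' - \sum_s' P s a s' * Vpol P r pick Q m s' <=
  \sum_s' P s a s' * clipval R S A P (fun m s => pick (Q m s))
    (fun s a => b s a + c s a + H%:R * e s a) (1 + l) H%:R m s'.
  by rewrite -sub; apply: ler_sum => s' _; rewrite ler_wpM2l// IHm.
have h5 := ler_wpM2l (_ : 0 <= 1 + l) h4.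
have {}h5 := h5 (addr_ge0 ler01 l_ge0).
(* The loss of the policy against V* enters with factor 1; being nonnegative, it can be weighted by
   [1 + l] like the rest. *)
have h6 := ler_wpM2l l_ge0 h3.
move: Qa h1 h2 h3 h5 h6; lra.
Qed.

End Planning.

(** * Pigeonhole sums *)

Lemma sum_sqrt_le (R : realType) (I : finType) (c : I -> R) (C : R) :
  (forall i, 0 <= c i) -> \sum_i c i = C -> 0 < C ->
  \sum_i Num.sqrt (c i) <= Num.sqrt (#|I|%:R * C).
Proof.
move=> c0 cC C0.
have I0 : 0 < #|I|%:R :> R.
  rewrite ltr0n lt0n; apply/negP => /eqP/card0_eq I0.
  by move: C0; rewrite -cC big_pred0 ?ltxx.
set y : R := Num.sqrt C; set x : R := Num.sqrt #|I|%:R.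
have y0 : 0 < y by rewrite sqrtr_gt0.
have x0 : 0 < x by rewrite sqrtr_gt0.
have yy : y ^+ 2 = C by rewrite sqr_sqrtr// ltW.
have xx : x ^+ 2 = #|I|%:R by rewrite sqr_sqrtr// ltW.
rewrite sqrtrM ?(ltW I0)// -/x -/y.
(* Cauchy-Schwarz as a weighted AM-GM inequality, with the weight [x / y] giving equality when all
   [c i] coincide. *)
have amgm i : Num.sqrt (c i) <= (c i * (x / y) + y / x) / 2.
  set z := Num.sqrt (c i); have zz : z ^+ 2 = c i by rewrite sqr_sqrtr.
  rewrite -zz -subr_ge0.
  have -> : (z ^+ 2 * (x / y) + y / x) / 2 - z = (z * x - y) ^+ 2 / (2 * x * y).
    by field; rewrite !gt_eqF.
  by rewrite divr_ge0 ?sqr_ge0// !mulr_ge0// ltW.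
apply: le_trans (_ : \sum_i (c i * (x / y) + y / x) / 2 <= _).
  by apply: ler_sum => i _; exact: amgm.
rewrite -mulr_suml big_split /= -mulr_suml cC sumr_const -[y / x *+ _]mulr_natr -xx -yy.
rewrite le_eqVlt; apply/predU1P; left; field.
by rewrite !gt_eqF.
Qed.

Section Pigeonhole.
Variables (R : realType) (H N : nat) (c : nat -> nat).
Hypothesis H0 : (0 < H)%N.
Hypothesis c0 : c 0 = 0%N.
Hypothesis c_mono : forall j, (c j <= c j.+1)%N.
Hypothesis c_step : forall j, (c j.+1 <= c j + H)%N.

Definition spread : R := 6 / 5 * (H%:R / (H%:R + N%:R)).

Let H0R : 0 < H%:R :> R. Proof. by rewrite ltr0n. Qed.

Lemma spread_gt0 : 0 < spread.
Proof. by rewrite mulr_gt0// divr_gt0// ltr_wpDr. Qed.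

Lemma count_le j : (c j <= j * H)%N.
Proof.
elim: j => [|j IHj]; first by rewrite c0.
by apply: leq_trans (c_step j) _; rewrite mulSn addnC leq_add2l.
Qed.

(** In the product of [c j.+1] and [H + N], the summand [N] is met with [c j.+1 <= j.+1 * H] and the
    summand [H] with [c j.+1 <= c j + H]; the excess [H ^ 2] is at most a fifth of
    [H * j.+1 * N]. *)
Lemma count_le_spread j : (5 * H <= j.+1 * N)%N ->
  (c j.+1)%:R <= spread * (c j + j.+1 * N)%:R.
Proof.
move=> good.
have HN : 0 < H%:R + N%:R :> R by rewrite ltr_wpDr.
have -> : spread * (c j + j.+1 * N)%:R =
    (6 * (H%:R * (c j + j.+1 * N)%:R)) / (5 * (H%:R + N%:R)).
  by rewrite /spread; field; rewrite gt_eqF.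
rewrite ler_pdivlMr; last by rewrite mulr_gt0.
have h : (5 * (c j.+1 * (H + N)) <= 6 * (H * (c j + j.+1 * N)))%N.
  have := count_le j.+1; have := c_step j; nia.
move: h; rewrite -(ler_nat R) !natrM !natrD; lra.
Qed.

(** Telescoping of the square roots of the counts: for successive roots [a <= b] the increment is
    [(b - a) * (b + a)], and [b] is at most [Num.sqrt spread] times the denominator. *)
Lemma pigeonhole_sqrt K :
  \sum_(j < K | (5 * H <= j.+1 * N)%N)
     (c j.+1 - c j)%:R / Num.sqrt (c j + j.+1 * N)%:R
  <= 2 * Num.sqrt spread * Num.sqrt (c K)%:R.
Proof.
elim: K => [|K IHK]; first by rewrite big_ord0 !mulr_ge0 ?sqrtr_ge0.
rewrite big_mkcond big_ord_recr -big_mkcond /=.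
have mono : Num.sqrt (c K)%:R <= Num.sqrt (c K.+1)%:R :> R.
  by rewrite ler_sqrt ?ler0n// ler_nat.
set s := Num.sqrt spread in IHK *; set a := Num.sqrt (c K)%:R in IHK mono *.
set b := Num.sqrt (c K.+1)%:R in mono *.
have s0 : 0 <= s by exact: sqrtr_ge0.
have a0 : 0 <= a by exact: sqrtr_ge0.
apply: le_trans (_ : 2 * s * a + 2 * s * (b - a) <= _); last by lra.
apply: lerD => //; case: ifPn => [good|_]; last by rewrite !mulr_ge0// subr_ge0.
have x0 : 0 < (c K + K.+1 * N)%:R :> R by rewrite ltr0n; lia.
set x := Num.sqrt (c K + K.+1 * N)%:R.
have X0 : 0 < x by rewrite sqrtr_gt0.
have bsx : b <= s * x.
  rewrite /s /x -sqrtrM ?(ltW spread_gt0)// ler_sqrt ?count_le_spread//.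
  by rewrite mulr_ge0// ?(ltW spread_gt0)// ltW.
have -> : (c K.+1 - c K)%:R = b ^+ 2 - a ^+ 2 :> R.
  by rewrite !sqr_sqrtr// natrB.
rewrite ler_pdivrMr//.
have -> : b ^+ 2 - a ^+ 2 = (b - a) * (b + a) by ring.
have -> : 2 * s * (b - a) * x = (b - a) * (2 * (s * x)) by ring.
by rewrite ler_wpM2l ?subr_ge0//; lra.
Qed.

(** A telescoping majorant of the harmonic sum: it starts at 0, and the first positive count pays
    the 1. *)
Definition ln_count (n : nat) : R := if n == 0%N then 0 else 1 + ln n%:R.

Lemma pigeonhole_inv K :
  \sum_(j < K | (5 * H <= j.+1 * N)%N)
     (c j.+1 - c j)%:R / (c j + j.+1 * N)%:R
  <= spread * ln_count (c K).
Proof.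
elim: K => [|K IHK]; first by rewrite big_ord0 c0 /ln_count eqxx mulr0.
rewrite big_mkcond big_ord_recr -big_mkcond /=.
have [e|ne] := eqVneq (c K.+1) (c K).
  by rewrite e subnn mul0r if_same addr0.
have lt : (c K < c K.+1)%N by rewrite ltn_neqAle eq_sym ne c_mono.
have b0 : 0 < (c K.+1)%:R :> R by rewrite ltr0n; lia.
have step : (c K.+1 - c K)%:R / (c K.+1)%:R <= ln_count (c K.+1) - ln_count (c K).
  rewrite /ln_count (gtn_eqF (leq_ltn_trans (leq0n _) lt)).
  have [->|a0] := eqVneq (c K) 0%N.
    by rewrite subn0 divff ?gt_eqF// subr0 lerDl ln_ge0// ler1n; lia.
  have a0R : 0 < (c K)%:R :> R by rewrite ltr0n; lia.
  (* For counts [a < b] this yields [1 - a / b <= ln b - ln a]. *)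
  have := @le_ln1Dx R ((c K)%:R / (c K.+1)%:R - 1).
  rewrite addrCA subrr addr0 ln_div ?posrE// natrB// mulrBl divff ?gt_eqF//.
  move=> h; have : -1 < (c K)%:R / (c K.+1)%:R - 1 :> R.
    by have := divr_gt0 a0R b0; lra.
  by move=> /h; lra.
apply: le_trans (_ : spread * ln_count (c K) +
  spread * (ln_count (c K.+1) - ln_count (c K)) <= _); last by lra.
have step0 : 0 <= ln_count (c K.+1) - ln_count (c K).
  by apply: le_trans step; rewrite divr_ge0.
apply: lerD => //; case: ifPn => [good|_]; last by rewrite mulr_ge0// ltW// spread_gt0.
have x0 : 0 < (c K + K.+1 * N)%:R :> R by rewrite ltr0n; lia.
apply: le_trans (ler_wpM2l (ltW spread_gt0) step).
rewrite mulrCA ler_wpM2l// ler_pdivlMr// mulrC ler_pdivrMr//.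
exact: count_le_spread.
Qed.

End Pigeonhole.

(** * Visit counts of a run and sums of inverse counts *)

Section Visits.
Variables (R : realType) (S A : finType) (H K N : nat).
Variables (r : S -> A -> R) (init : 'I_K -> S) (p : R).
Variable pick : (A -> R) -> A.
Variable w : Om S A H K N.

Local Notation hist := (cHk r init p pick).
Local Notation own := (ownCounts r init p pick w).
Local Notation cura j h := (cur init w j h, act r init p pick w j (hist w j) h).

Definition visits (n : nat) (sa : S * A) : nat := Nvis (own n) sa.1 sa.2.

Lemma visitsS (jo : 'I_K) sa :
  visits jo.+1 sa = (visits jo sa + \sum_(h < H) (cura jo h == sa))%N.
Proof.
rewrite /visits /Nvis /= valK big_split /=; congr (_ + _)%N.
rewrite exchange_big /=; apply: eq_bigr => h _.
case: sa => s a /=; rewrite (bigD1 ((w jo).2 h)) //= !xpair_eqE eqxx andbT.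
by rewrite big1 ?addn0// => s'; rewrite !xpair_eqE eq_sym => /negbTE ->; rewrite andbF.
Qed.

(** Counts freeze after the last episode, so the pigeonhole hypotheses on [c] hold for all natural
    numbers. *)
Lemma visits_out n sa : (K <= n)%N -> visits n.+1 sa = visits n sa.
Proof.
move=> Kn; rewrite /visits /Nvis /=; apply: eq_bigr => s' _.
by rewrite insubF ?addn0// ltnNge Kn.
Qed.

Lemma visits_mono n sa : (visits n sa <= visits n.+1 sa)%N.
Proof.
have [nK|Kn] := ltnP n K; last by rewrite visits_out.
by rewrite (visitsS (Ordinal nK)) leq_addr.
Qed.

Lemma visits_step n sa : (visits n.+1 sa <= visits n sa + H)%N.
Proof.
have [nK|Kn] := ltnP n K; last by rewrite visits_out// leq_addr.
rewrite (visitsS (Ordinal nK)) leq_add2l.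
rewrite -[leqRHS]card_ord -sum1_card; apply: leq_sum => h _; exact: leq_b1.
Qed.

Lemma visits0 sa : visits 0 sa = 0%N.
Proof. by rewrite /visits /Nvis /= big1. Qed.

Lemma visits_total n : (n <= K)%N -> (\sum_sa visits n sa = n * H)%N.
Proof.
elim: n => [|n IHn] nK; first by rewrite big1// => sa _; rewrite visits0.
under eq_bigr do rewrite (visitsS (Ordinal nK)).
rewrite big_split /= IHn 1?ltnW// mulSn addnC; congr (_ + _)%N.
rewrite exchange_big /= -[RHS]card_ord -sum1_card; apply: eq_bigr => h _.
rewrite (bigD1 (cura (Ordinal nK) h)) //= eqxx big1// => sa.
by rewrite eq_sym => /negbTE ->.
Qed.

Lemma sum_along_visits (jo : 'I_K) (f : S * A -> R) :
  \sum_(h < H) f (cura jo h) = \sum_sa (visits jo.+1 sa - visits jo sa)%:R * f sa.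
Proof.
under [RHS]eq_bigr do rewrite visitsS addKn natr_sum mulr_suml.
rewrite exchange_big /=; apply: eq_bigr => h _.
rewrite (bigD1 (cura jo h)) //= eqxx mul1r big1 ?addr0// => sa.
by rewrite eq_sym => /negbTE ->; rewrite mul0r.
Qed.

Hypothesis H0 : (0 < H)%N.
Hypothesis K0 : (0 < K)%N.

(** Regrouping the steps by state-action pair gives pigeonhole sums. The square roots are combined
    by Cauchy-Schwarz, the counts adding up to [K * H]; inside the logarithm each count is bounded
    by [K * H]. *)
Lemma sum_inv_counts (al be : R) : 0 <= al -> 0 <= be ->
  \sum_(jo < K | (5 * H <= jo.+1 * N)%N) \sum_(h < H)
    (al / Num.sqrt (visits jo (cura jo h) + jo.+1 * N)%:R +
     be / (visits jo (cura jo h) + jo.+1 * N)%:R)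
  <= al * (2 * Num.sqrt (spread R H N) * Num.sqrt ((#|S| * #|A|)%:R * (K * H)%:R)) +
     be * (spread R H N * ((#|S| * #|A|)%:R * (1 + ln (K * H)%:R))).
Proof.
move=> al0 be0.
under eq_bigr => jo _ do rewrite (sum_along_visits jo (fun sa =>
  al / Num.sqrt (visits jo sa + jo.+1 * N)%:R + be / (visits jo sa + jo.+1 * N)%:R)).
rewrite exchange_big /=.
have KH0 : 0 < (K * H)%:R :> R by rewrite ltr0n muln_gt0 K0.
have cardE : #|{: S * A}| = (#|S| * #|A|)%N by rewrite card_prod.
have step sa : \sum_(jo < K | (5 * H <= jo.+1 * N)%N)
    (visits jo.+1 sa - visits jo sa)%:R *
    (al / Num.sqrt (visits jo sa + jo.+1 * N)%:R + be / (visits jo sa + jo.+1 * N)%:R)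
  <= al * (2 * Num.sqrt (spread R H N)) * Num.sqrt (visits K sa)%:R +
     be * spread R H N * (1 + ln (K * H)%:R).
  have pS := pigeonhole_sqrt R H N (visits^~ sa) H0 (visits0 sa) (visits_mono^~ sa)
    (visits_step^~ sa) K.
  have pI := pigeonhole_inv R H N (visits^~ sa) H0 (visits0 sa) (visits_mono^~ sa)
    (visits_step^~ sa) K.
  rewrite (eq_bigr (fun jo : 'I_K =>
    al * ((visits jo.+1 sa - visits jo sa)%:R / Num.sqrt (visits jo sa + jo.+1 * N)%:R) +
    be * ((visits jo.+1 sa - visits jo sa)%:R / (visits jo sa + jo.+1 * N)%:R))); last first.
    by move=> jo _; ring.
  rewrite big_split /= -!mulr_sumr; apply: lerD.
    by rewrite -mulrA ler_wpM2l.
  rewrite -mulrA ler_wpM2l//; apply: le_trans pI _.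
  rewrite ler_wpM2l ?(ltW (spread_gt0 R H N H0))// /ln_count.
  have vKH : (visits K sa <= K * H)%N.
    exact: (count_le H (visits^~ sa) (visits0 sa) (visits_step^~ sa)).
  case: eqP => [_|/eqP v0]; first by rewrite addr_ge0// ln_ge0// ler1n muln_gt0 K0.
  by rewrite lerD2l ler_ln ?posrE// ?ltr0n ?lt0n// ler_nat.
apply: le_trans (_ : \sum_sa (al * (2 * Num.sqrt (spread R H N)) *
    Num.sqrt (visits K sa)%:R + be * spread R H N * (1 + ln (K * H)%:R)) <= _).
  by apply: ler_sum => sa _; exact: step.
rewrite big_split /= -mulr_sumr sumr_const cardE -mulr_natr; apply: lerD; last first.
  by rewrite le_eqVlt; apply/predU1P; left; ring.
rewrite -mulrA ler_wpM2l// ler_wpM2l ?mulr_ge0 ?sqrtr_ge0// -cardE.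
by apply: sum_sqrt_le => //; rewrite -natr_sum visits_total.
Qed.

End Visits.

(** * Deviation events *)

Section GoodEvent.
Variables (R : realType) (S A : finType) (H K N : nat).
Variables (P : S -> A -> S -> R) (r : S -> A -> R) (init : 'I_K -> S) (p : R).
Variable pick : (A -> R) -> A.
Hypothesis H_gt0 : (0 < H)%N.
Hypothesis N_gt0 : (0 < N)%N.
Hypothesis P_ge0 : forall s a s', 0 <= P s a s'.
Hypothesis P_sum1 : forall s a, \sum_(s' : S) P s a s' = 1.
Hypothesis r01 : forall s a, 0 <= r s a <= 1.
Hypothesis pick_max : forall (f : A -> R) (a : A), f a <= f (pick f).

Local Notation Run := (Om S A H K N).
Local Notation hist := (cHk r init p pick).
Local Notation massw := (mass P r init p pick).
Local Notation L := (LN S A H K N p).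
Local Notation V := (Vstar P r pick).
Implicit Types (w : Run) (jo : 'I_K).

(** Outside [E] some [X i] reaches [th i], so the sum of the [expR (X i w - th i)] is at least 1
    there, while its mean is at most [p]. *)
Lemma Prob_ge (I : finType) (X : I -> Run -> R) (th : I -> R) (E : pred Run) :
  (forall i, \sum_(w : Run) massw w * expR (X i w) <= 1) ->
  \sum_i expR (- th i) <= p ->
  (forall w, (forall i, X i w < th i) -> E w) ->
  1 - p <= Prob P r init p pick E.
Proof.
move=> X1 thp XE.
have m0 w : 0 <= massw w by exact: mass_ge0.
rewrite -(mass_sum1 R S A H K N P r init p pick P_ge0 P_sum1) /Prob (bigID E) /=.
rewrite lerBlDr lerD2l; apply: le_trans thp.
apply: le_trans (_ : \sum_(w : Run) massw w * \sum_i expR (X i w - th i) <= _); last first.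
  under eq_bigr do rewrite mulr_sumr; rewrite exchange_big /=.
  apply: ler_sum => i _; under eq_bigr do rewrite expRD mulrA.
  by rewrite -mulr_suml ler_piMl ?expR_ge0.
rewrite big_mkcond /=; apply: ler_sum => w _.
have sum0 (Q : pred I) : 0 <= \sum_(i | Q i) expR (X i w - th i).
  by apply: sumr_ge0 => i _; exact: expR_ge0.
case: ifPn => [nE|_]; last by rewrite mulr_ge0.
have [i Xi] : exists i, th i <= X i w.
  apply: contrapT => /forallNP h; move/negP: nE; apply; apply: XE => i.
  by rewrite ltNge; apply/negP; exact: h.
rewrite ler_peMr// (bigD1 i) //=; apply: le_trans (_ : expR (X i w - th i) <= _).
  by rewrite -expR0 ler_expR subr_ge0.
by rewrite lerDl.
Qed.

Definition nobs w jo s a : nat := (visits R S A H K N r init p pick w jo (s, a) + jo.+1 * N)%N.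

Lemma nobs_gt0 w jo s a : (0 < nobs w jo s a)%N.
Proof. by rewrite addn_gt0 muln_gt0 N_gt0 orbT. Qed.

(** Makes finite the range of counts for which a separate deviation event is required. *)
Lemma nobs_le w jo s a : (nobs w jo s a <= K * (H + N))%N.
Proof.
have h : (visits R S A H K N r init p pick w jo (s, a) <= jo * H)%N.
  exact: (count_le H (visits R S A H K N r init p pick w ^~ (s, a))
    (visits0 R S A H K N r init p pick w (s, a))
    (visits_step R S A H K N r init p pick w ^~ (s, a))).
rewrite mulnDr leq_add//; last by rewrite leq_mul2r ltn_ord orbT.
by apply: leq_trans h _; rewrite leq_mul2r (ltnW (ltn_ord jo)) orbT.
Qed.

Definition obs w jo s a s' : nat := (hist w jo s a s' + extCount w jo s a s')%N.

Lemma sum_obs w jo s a : (\sum_s' obs w jo s a s')%N = nobs w jo s a.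
Proof.
rewrite /obs big_split /=; congr (_ + _)%N.
apply/eqP; rewrite -(eqr_nat R) natr_sum.
under eq_bigr do rewrite -[_%:R]mulr1.
rewrite (sum_count_ext R S A H K N (fun _ => 1)).
under eq_bigr do rewrite sumr_const card_ord.
rewrite (eq_bigl (fun j : 'I_K => (j < jo.+1)%N))//.
rewrite -(big_ord_widen K (fun _ => N%:R : R)); last exact: ltn_ord.
by rewrite sumr_const card_ord mulnC natrM mulr_natr.
Qed.

Lemma Phat_sum (f : S -> R) w jo s a (Q : pred S) :
  \sum_(s' | Q s') Phat R w jo (hist w jo) s a s' * f s' =
  (\sum_(s' | Q s') (obs w jo s a s')%:R * f s') / (nobs w jo s a)%:R.
Proof.
by rewrite mulr_suml; apply: eq_bigr => s' _; rewrite /Phat mulrAC.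
Qed.

Lemma Phat_ge0 w jo s a s' : 0 <= Phat R w jo (hist w jo) s a s'.
Proof. by rewrite /Phat divr_ge0. Qed.

Lemma Phat_sum1 w jo s a : \sum_s' Phat R w jo (hist w jo) s a s' = 1.
Proof.
under eq_bigr do rewrite -[Phat _ _ _ _ _ _ _]mulr1.
rewrite (Phat_sum (fun _ => 1)); under eq_bigr do rewrite mulr1.
by rewrite -natr_sum sum_obs divff// pnatr_eq0 -lt0n nobs_gt0.
Qed.

(* Set to 0 when [n] is so small that the resulting estimate is trivial. *)
Definition hoeffding_scale (n : nat) : R :=
  if 2 * L <= Num.sqrt n%:R then L / (H%:R * Num.sqrt n%:R) else 0.

(** [b] selects the tail. [n] is a guess of the number of observations: the moment bound needs a
    deterministic scale, so every possible count gets its own exponent. *)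
Definition value_exponent (b : bool) (m n : nat) s a s' : R :=
  let l := (-1) ^+ b * hoeffding_scale n in
  l * (V m s' - \sum_t P s a t * V m t) - l ^+ 2 * H%:R ^+ 2.

Definition chernoff_scale : R := 9 / 20 / H%:R.

Definition set_exponent (T : {set S}) s a s' : R :=
  chernoff_scale * (s' \in T)%:R - chernoff_scale * (1 + chernoff_scale) * \sum_(t in T) P s a t.

Definition sample_sum w jo s a (f : S -> R) : R := \sum_s' (obs w jo s a s')%:R * f s'.

Let HR : 0 < H%:R :> R. Proof. by rewrite ltr0n. Qed.
Let HR1 : 1 <= H%:R :> R. Proof. by rewrite ler1n. Qed.

Hypothesis L_ge2 : 2 <= L.

Lemma value_exponent_mgf b m n jo s a : (m <= H)%N ->
  \sum_(w : Run) massw w * expR (sample_sum w jo s a (value_exponent b m n s a)) <= 1.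
Proof.
move=> mH; have L2 := L_ge2; have h0 := HR.
apply: sample_mgf => //; apply: expR_mgf_centered => //.
- move=> s'; have := Vstar_itv R S A P r pick P_ge0 P_sum1 r01 m s'.
  have : m%:R <= H%:R :> R by rewrite ler_nat.
  lra.
(* The threshold in [hoeffding_scale] keeps the scale times [H] at most 1/2. *)
- rewrite normrM normrX normrN1 expr1n mul1r /hoeffding_scale; case: ifPn => [h|_].
    have x0 : 0 < Num.sqrt n%:R :> R by lra.
    rewrite ger0_norm; last by rewrite divr_ge0 ?mulr_ge0//; lra.
    have -> : L / (H%:R * Num.sqrt n%:R) * H%:R = L / Num.sqrt n%:R.
      by field; rewrite !gt_eqF.
    by rewrite ler_pdivrMr//; lra.
  by rewrite normr0 mul0r invr_ge0.
Qed.

Lemma chernoff_scale_itv : 0 < chernoff_scale <= 2^-1.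
Proof.
have h := HR1; have h0 := HR.
rewrite /chernoff_scale; apply/andP; split; first by rewrite !divr_gt0.
rewrite ler_pdivrMr//; lra.
Qed.

Lemma set_exponent_mgf T jo s a :
  \sum_(w : Run) massw w * expR (sample_sum w jo s a (set_exponent T s a)) <= 1.
Proof.
apply: sample_mgf => //; apply: expR_mgf_indicator => //.
by have := chernoff_scale_itv; lra.
Qed.

Definition value_radius w jo s a : R := 2 * H%:R * L / Num.sqrt (nobs w jo s a)%:R.

Definition set_radius w jo s a : R := (L + #|S|%:R) / (chernoff_scale * (nobs w jo s a)%:R).

Lemma dev_value w jo s a m : (m <= H)%N ->
  (forall b, sample_sum w jo s a (value_exponent b m (nobs w jo s a) s a) < 2 * L) ->
  `|\sum_s' Phat R w jo (hist w jo) s a s' * V m s' - \sum_s' P s a s' * V m s'|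
    <= value_radius w jo s a.
Proof.
move=> mH dev; rewrite /value_radius; set n := nobs w jo s a in dev *.
set mu := \sum_s' P s a s' * V m s'; set nu := \sum_s' Phat _ _ _ _ _ _ _ * _.
have n0 : 0 < n%:R :> R by rewrite ltr0n nobs_gt0.
set x : R := Num.sqrt n%:R.
have x0 : 0 < x by rewrite sqrtr_gt0.
have xx : n%:R = x ^+ 2 by rewrite sqr_sqrtr// ltW.
have L2 := L_ge2; have h0 := HR.
have V01 s' : 0 <= V m s' <= H%:R.
  have := Vstar_itv R S A P r pick P_ge0 P_sum1 r01 m s'.
  have : m%:R <= H%:R :> R by rewrite ler_nat.
  lra.
have mu01 : 0 <= mu <= H%:R by apply: expect_itv.
have nu01 : 0 <= nu <= H%:R.
  by apply: expect_itv => //; [move=> s'; exact: Phat_ge0|exact: Phat_sum1].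
(* If [x < 2 * L] the radius exceeds [H], which bounds the difference of two averages of V*
   anyway. *)
have [Lx|xL] := leP (2 * L) x; last first.
  apply: le_trans (_ : H%:R <= _); first by rewrite ler_norml; lra.
  rewrite ler_pdivlMr// (_ : 2 * H%:R * L = H%:R * (2 * L)); last by ring.
  by rewrite ler_wpM2l ?(ltW xL)// ltW.
have sd b : sample_sum w jo s a (value_exponent b m n s a) =
    (-1) ^+ b * (L / (H%:R * x)) * (n%:R * (nu - mu)) - L ^+ 2.
  rewrite /sample_sum /value_exponent /hoeffding_scale -/x Lx -/mu; set l := (-1) ^+ b * _.
  have l2 : n%:R * (l ^+ 2 * H%:R ^+ 2) = L ^+ 2.
    by rewrite /l exprMn sqrr_sign xx; field; rewrite !gt_eqF.
  rewrite -[in RHS]l2.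
  have -> : n%:R * (nu - mu) = \sum_s' (obs w jo s a s')%:R * (V m s' - mu).
    under [RHS]eq_bigr do rewrite mulrBr.
    rewrite sumrB -mulr_suml -natr_sum sum_obs -/n mulrBr; congr (_ - _).
    by rewrite /nu Phat_sum -/n mulrCA divff ?gt_eqF// mulr1.
  rewrite -[X in _ - X * _](_ : \sum_s' (obs w jo s a s')%:R = n%:R); last first.
    by rewrite -natr_sum sum_obs.
  rewrite mulr_sumr mulr_suml -sumrB; apply: eq_bigr => s' _.
  by ring.
(* The compensators add up to [L ^+ 2], so the signed error times [x * L / H] is below
   [2 * L + L ^+ 2], at most [2 * L ^+ 2] since [2 <= L]. *)
have main (b : bool) : (-1) ^+ b * (nu - mu) <= 2 * H%:R * L / x.
  have := dev b; rewrite sd xx => h.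
  have {}h : (-1) ^+ b * (nu - mu) * x * L < H%:R * (2 * L + L ^+ 2).
    rewrite -ltr_pdivrMl//; move: h; rewrite -ltrBlDr.
    have -> : (-1) ^+ b * (L / (H%:R * x)) * (x ^+ 2 * (nu - mu)) =
      H%:R^-1 * ((-1) ^+ b * (nu - mu) * x * L) by field; rewrite !gt_eqF.
    lra.
  rewrite ler_pdivlMr// -(ler_pM2r (_ : 0 < L)); last lra.
  apply: le_trans (ltW h) _.
  have -> : 2 * H%:R * L * L = H%:R * (2 * L ^+ 2) by ring.
  rewrite ler_wpM2l ?(ltW h0)//.
  have : 0 <= (L - 2) * L by rewrite mulr_ge0; lra.
  lra.
have := main false; have := main true; rewrite expr0 expr1 ler_norml; lra.
Qed.

Lemma dev_set w jo s a (T : {set S}) :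
  sample_sum w jo s a (set_exponent T s a) < L + #|S|%:R ->
  \sum_(s' in T) Phat R w jo (hist w jo) s a s' <=
  (1 + chernoff_scale) * \sum_(s' in T) P s a s' + set_radius w jo s a.
Proof.
have /andP[l0 _] := chernoff_scale_itv.
rewrite /set_radius; set n := nobs w jo s a.
have n0 : 0 < n%:R :> R by rewrite ltr0n nobs_gt0.
set pT := \sum_(s' in T) P s a s'.
set qT := \sum_(s' in T) Phat _ _ _ _ _ _ _.
have -> : sample_sum w jo s a (set_exponent T s a) =
    chernoff_scale * (n%:R * qT) - n%:R * (chernoff_scale * (1 + chernoff_scale) * pT).
  have -> : n%:R * qT = \sum_s' (obs w jo s a s')%:R * (s' \in T)%:R.
    rewrite /qT; under eq_bigr do rewrite -[Phat _ _ _ _ _ _ _]mulr1.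
    rewrite (Phat_sum (fun _ => 1)) -/n mulrCA divff ?gt_eqF// mulr1 big_mkcond /=.
    by apply: eq_bigr => s' _; case: (s' \in T); rewrite ?mulr1 ?mulr0.
  rewrite -[X in _ = _ - X * _](_ : \sum_s' (obs w jo s a s')%:R = n%:R); last first.
    by rewrite -natr_sum sum_obs.
  rewrite mulr_sumr mulr_suml -sumrB; apply: eq_bigr => s' _.
  by rewrite /set_exponent -/pT; ring.
move=> h; rewrite -lerBlDl ler_pdivlMr; last exact: mulr_gt0.
by apply: ltW; apply: le_lt_trans h; rewrite le_eqVlt; apply/predU1P; left; ring.
Qed.

End GoodEvent.

(** * The logarithmic factor and the total weight of the deviation events *)

Section LogFactor.
Variables (R : realType) (S A : finType) (H K N : nat) (p : R).
Hypothesis S_gt0 : (0 < #|S|)%N.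
Hypothesis A_gt0 : (0 < #|A|)%N.
Hypothesis H_gt0 : (0 < H)%N.
Hypothesis K_gt0 : (0 < K)%N.
Hypothesis N_gt0 : (0 < N)%N.
Hypothesis p01 : 0 < p < 1.

Local Notation L := (LN S A H K N p).
Local Notation arg := (5 * #|S| * #|A| * K * (H + N))%N.

Lemma LN_arg_gt0 : (0 < arg)%N.
Proof. by rewrite !muln_gt0 addn_gt0 S_gt0 A_gt0 H_gt0 K_gt0. Qed.

Lemma expRN_LN : expR (- L) = p / arg%:R.
Proof.
have /andP[p0 _] := p01; have a0 : 0 < arg%:R :> R by rewrite ltr0n LN_arg_gt0.
by rewrite /LN expRN lnK ?posrE ?divr_gt0// invf_div.
Qed.

Lemma le_LN (x : R) (m : nat) : 0 < x -> x <= m%:R -> (m <= arg)%N -> ln x <= L.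
Proof.
move=> x0 xm marg; have /andP[p0 p1] := p01.
have a0 : 0 < arg%:R :> R by rewrite ltr0n LN_arg_gt0.
rewrite /LN ler_ln ?posrE ?divr_gt0// ler_pdivlMr//.
apply: le_trans (_ : x <= _); first by rewrite ler_piMr// ltW.
by apply: le_trans xm _; rewrite ler_nat.
Qed.

Lemma LN_ge2 : 2 <= L.
Proof.
(* [H + N >= 2] makes the argument at least 10, and the square of e is at most that of 25/8, below
   10. *)
rewrite -[leLHS]expRK; apply: (le_LN _ 10); rewrite ?expR_gt0//.
  have -> : 2 = 2%:R * 1 :> R by ring.
  rewrite expRM_natl; have := expR1_le R; have := expR_ge0 (1 : R).
  by set e := expR 1 => e0 e1; have := ler_pM e0 e0 e1 e1; lra.
have : (1 <= #|S| * #|A| * K)%N by rewrite !muln_gt0 S_gt0 A_gt0.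
by move: H_gt0 N_gt0; set z := (#|S| * #|A| * K)%N => H1 N1 z1; rewrite -!mulnA !mulnA; nia.
Qed.

Lemma LN_ge_lnKH : 1 + ln (K * H)%:R <= L.
Proof.
have KH0 : 0 < (K * H)%:R :> R by rewrite ltr0n muln_gt0 K_gt0.
have -> : 1 + ln (K * H)%:R = ln (expR 1 * (K * H)%:R) :> R.
  by rewrite lnM ?posrE ?expR_gt0// expRK.
apply: (le_LN _ (5 * (K * H))); first exact: mulr_gt0 (expR_gt0 _) KH0.
  by rewrite (natrM _ 5) ler_wpM2r ?(ltW KH0)//; have := expR1_le R; lra.
have : (1 <= #|S| * #|A|)%N by rewrite !muln_gt0 S_gt0 A_gt0.
by set z := (#|S| * #|A|)%N => z1; nia.
Qed.

(** Each kind of event weighs at most [p / 10]. The threshold [L + #|S|] pays for the [2 ^ #|S|]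
    sets through [2 <= expR 1]; [2 * L] pays for the choice of a horizon, a count and a sign. *)
Lemma family_weights :
  \sum_(i : 'I_K * S * A * {set S}) expR (- (L + #|S|%:R)) +
  \sum_(i : 'I_K * S * A * 'I_H * 'I_(K * (H + N)) * bool) expR (- (2 * L)) +
  expR (- L) <= p.
Proof.
have /andP[p0 p1] := p01.
have e2 : 2 <= expR 1 :> R by have := expR1_gt R; lra.
have e2S : (2 ^ #|S|)%N%:R <= expR #|S|%:R :> R.
  rewrite natrX -[X in expR X]mulr1 expRM_natl.
  by apply: lerXn2r; rewrite ?nnegrE ?expR_ge0// ler0n.
have cset : #|{: {set S}}| = (2 ^ #|S|)%N.
  by rewrite -[LHS]cardsT -powersetT card_powerset cardsT.
rewrite !sumr_const !card_prod !card_ord card_bool cset.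
have a0 : 0 < #|S|%:R :> R by rewrite ltr0n.
have b0 : 0 < #|A|%:R :> R by rewrite ltr0n.
have k0 : 0 < K%:R :> R by rewrite ltr0n.
have a1 : 1 <= #|S|%:R :> R by rewrite ler1n.
have b1 : 1 <= #|A|%:R :> R by rewrite ler1n.
have k1 : 1 <= K%:R :> R by rewrite ler1n.
have h1 : 1 <= H%:R :> R by rewrite ler1n.
have n1 : 1 <= N%:R :> R by rewrite ler1n.
have hn0 : 0 < H%:R + N%:R :> R by lra.
have abk1 : 1 <= #|S|%:R * #|A|%:R * K%:R :> R.
  by rewrite -[leLHS]mulr1 ler_pM// -[leLHS]mulr1 ler_pM.
have argE : arg%:R = 5 * #|S|%:R * #|A|%:R * K%:R * (H%:R + N%:R) :> R.
  by rewrite 4!natrM natrD.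
have q0 : 0 <= p / arg%:R by rewrite divr_ge0// ltW.
have q1 : (p / arg%:R) * (#|S|%:R * #|A|%:R * K%:R) <= p / 10.
  have -> : (p / arg%:R) * (#|S|%:R * #|A|%:R * K%:R) = p / (5 * (H%:R + N%:R)).
    by rewrite argE; field; rewrite !gt_eqF.
  rewrite ler_wpM2l ?(ltW p0)// lef_pV2 ?posrE//; lra.
have w1 : expR (- (L + #|S|%:R)) *+ (K * #|S| * #|A| * 2 ^ #|S|)%N <= p / 10.
  rewrite opprD expRD expRN_LN -[X in X <= _]mulr_natr (natrM _ (K * #|S| * #|A|)%N).
  set q := p / arg%:R in q0 q1 *; rewrite mulrACA.
  apply: le_trans q1; rewrite 2!natrM -[leRHS]mulr1.
  apply: ler_pM => //;
    [by apply: mulr_ge0 => //; rewrite -!natrM ler0n|by rewrite mulr_ge0 ?expR_ge0| |].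
    by rewrite le_eqVlt; apply/predU1P; left; ring.
  by rewrite mulrC expRN ler_pdivrMr ?expR_gt0// mul1r.
have w2 : expR (- (2 * L)) *+ (K * #|S| * #|A| * H * (K * (H + N)) * 2)%N <= p / 10.
  have -> : expR (- (2 * L)) = (p / arg%:R) ^+ 2 by rewrite -expRN_LN -expRM_natl mulrN.
  rewrite -[X in X <= _]mulr_natr.
  have -> : (K * #|S| * #|A| * H * (K * (H + N)) * 2)%N%:R =
      K%:R * #|S|%:R * #|A|%:R * H%:R * (K%:R * (H%:R + N%:R)) * 2 :> R.
    by rewrite !natrM natrD.
  have -> : (p / arg%:R) ^+ 2 *
      (K%:R * #|S|%:R * #|A|%:R * H%:R * (K%:R * (H%:R + N%:R)) * 2) =
    p * (p * (H%:R * 2) / (25 * (#|S|%:R * #|A|%:R) * (H%:R + N%:R))).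
    by rewrite argE; field; rewrite !gt_eqF.
  rewrite ler_wpM2l ?(ltW p0)// ler_pdivrMr ?mulr_gt0//.
  have h2 : p * (H%:R * 2) <= 1 * (H%:R * 2) by rewrite ler_wpM2r ?(ltW p1)//; lra.
  have ab1 : 1 <= #|S|%:R * #|A|%:R :> R by rewrite -[leLHS]mulr1 ler_pM.
  have h3 : H%:R + N%:R <= (#|S|%:R * #|A|%:R) * (H%:R + N%:R) :> R.
    by rewrite ler_peMl// ltW.
  lra.
have w3 : expR (- L) <= p / 10.
  rewrite expRN_LN; apply: le_trans q1.
  by rewrite -[leLHS]mulr1 ler_wpM2l.
lra.
Qed.

End LogFactor.

(** * Regret *)

Section Regret.
Variables (R : realType) (S A : finType) (H K N : nat).
Variables (P : S -> A -> S -> R) (r : S -> A -> R) (init : 'I_K -> S) (p : R).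
Variable pick : (A -> R) -> A.
Hypothesis H_gt0 : (0 < H)%N.
Hypothesis K_gt0 : (0 < K)%N.
Hypothesis N_gt0 : (0 < N)%N.
Hypothesis p01 : 0 < p < 1.
Hypothesis P_ge0 : forall s a s', 0 <= P s a s'.
Hypothesis P_sum1 : forall s a, \sum_(s' : S) P s a s' = 1.
Hypothesis r01 : forall s a, 0 <= r s a <= 1.
Hypothesis pick_max : forall (f : A -> R) (a : A), f a <= f (pick f).

Local Notation Run := (Om S A H K N).
Local Notation hist := (cHk r init p pick).
Local Notation massw := (mass P r init p pick).
Local Notation L := (LN S A H K N p).
Local Notation V := (Vstar P r pick).
Local Notation lT := (chernoff_scale R H).
Local Notation nobs := (nobs R S A H K N r init p pick).
Local Notation policy := (policy_of R S A H K N r init p pick).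
Implicit Types (w : Run) (jo : 'I_K).

Lemma S_gt0 : (0 < #|S|)%N.
Proof. by apply/card_gt0P; exists (init (Ordinal K_gt0)). Qed.

Lemma A_gt0 : (0 < #|A|)%N.
Proof. by apply/card_gt0P; exists (pick (fun _ => 0)). Qed.

Let HR : 0 < H%:R :> R. Proof. by rewrite ltr0n. Qed.
Let HR1 : 1 <= H%:R :> R. Proof. by rewrite ler1n. Qed.
Let NR : 1 <= N%:R :> R. Proof. by rewrite ler1n. Qed.
Let KR : 1 <= K%:R :> R. Proof. by rewrite ler1n. Qed.
Let SR : 1 <= #|S|%:R :> R. Proof. by rewrite ler1n S_gt0. Qed.
Let AR : 1 <= #|A|%:R :> R. Proof. by rewrite ler1n A_gt0. Qed.

Let L2 : 2 <= L.
Proof. by apply: LN_ge2 => //; [exact: S_gt0|exact: A_gt0]. Qed.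

Let lT_itv : 0 < lT <= 2^-1. Proof. exact: chernoff_scale_itv. Qed.

Definition gcost w jo s a : R :=
  bonus H N p jo (hist w jo) s a + value_radius R S A H K N r init p pick w jo s a
  + H%:R * set_radius R S A H K N r init p pick w jo s a.

Lemma value_radius_ge0 w jo s a : 0 <= value_radius R S A H K N r init p pick w jo s a.
Proof.
by have l2 := L2; have h0 := HR; rewrite /value_radius divr_ge0 ?sqrtr_ge0// mulr_ge0//; lra.
Qed.

Lemma set_radius_ge0 w jo s a : 0 <= set_radius R S A H K N r init p pick w jo s a.
Proof.
have /andP[l0 _] := lT_itv; have l2 := L2; have s1 := SR.
rewrite /set_radius; apply: divr_ge0; first by lra.
by apply: mulr_ge0 => //; exact: ltW.
Qed.

Lemma bonusE w jo s a : bonus H N p jo (hist w jo) s a =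
  7 * H%:R * L / Num.sqrt (nobs w jo s a)%:R.
Proof. by rewrite /bonus div1r sqrtrV. Qed.

Lemma value_radius_le_bonus w jo s a :
  value_radius R S A H K N r init p pick w jo s a <= bonus H N p jo (hist w jo) s a.
Proof.
have h0 := HR; have l2 := L2.
rewrite bonusE /value_radius ler_wpM2r ?invr_ge0 ?sqrtr_ge0//.
have : 0 <= H%:R * L by rewrite mulr_ge0; lra.
lra.
Qed.

Lemma gcost_ge0 w jo s a : 0 <= gcost w jo s a.
Proof.
have h1 := value_radius_ge0 w jo s a.
rewrite addr_ge0//; last by rewrite mulr_ge0// set_radius_ge0.
by rewrite addr_ge0//; apply: le_trans h1 (value_radius_le_bonus _ _ _ _).
Qed.

Lemma gcost_le w jo s a : gcost w jo s a <=
  9 * H%:R * L / Num.sqrt (nobs w jo s a)%:R +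
  10 / 3 * #|S|%:R * H%:R ^+ 2 * L / (nobs w jo s a)%:R.
Proof.
have h0 := HR; have l2 := L2; have s1 := SR.
rewrite /gcost bonusE /value_radius /set_radius -mulrDl.
set n := nobs w jo s a.
have n0 : 0 < n%:R :> R by rewrite ltr0n nobs_gt0.
apply: lerD.
  by rewrite ler_wpM2r ?invr_ge0 ?sqrtr_ge0//; lra.
have -> : H%:R * ((L + #|S|%:R) / (lT * n%:R)) =
    (20 / 9 * H%:R ^+ 2 * (L + #|S|%:R)) / n%:R.
  by rewrite /chernoff_scale; field; rewrite !gt_eqF.
rewrite ler_wpM2r ?invr_ge0 ?(ltW n0)//.
(* From [1 <= #|S|] and [2 <= L]; times 20/9 it gives the constant 10/3. *)
have h : L + #|S|%:R <= 3 / 2 * (#|S|%:R * L).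
  have : L <= #|S|%:R * L by rewrite ler_peMl//; lra.
  have : #|S|%:R * 2 <= #|S|%:R * L by rewrite ler_wpM2l//; lra.
  lra.
have := ler_wpM2l (sqr_ge0 (H%:R : R)) h; lra.
Qed.

(** The costs involve the oracle draws only through their number, so the earlier episodes determine
    them. *)
Lemma eq_gcost w w' jo : agree jo w w' -> gcost w jo = gcost w' jo.
Proof.
move=> aw; have e := eq_hist R S A H K N r init p pick w w' jo aw.
have en s a : nobs w jo s a = nobs w' jo s a.
  by rewrite -[LHS]/(ntot N (hist w jo) jo s a) e.
by apply/funext => s; apply/funext => a; rewrite /gcost /value_radius /set_radius e en.
Qed.

(* [capB] leaves room for one more clipped value after [capC] is reached (see
   [cap_room]), and [2 * capB * H <= (e (H + 1)) ^ 2] accounts for the term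
   [e (H + 1) sqrt (K L)] of the bound. *)
Definition capC : R := 9 / 5 * H%:R.
Definition capB : R := 17 / 5 * H%:R.

Definition clipped_value w jo : R :=
  clipval R S A P (policy w jo) (gcost w jo) (1 + lT) H%:R H (init jo).

Definition cost w jo : R :=
  tcost R S A H (init jo) (policy w jo) (gcost w jo) (1 + lT) H (w jo).2.

Lemma discount_le n : (n <= H)%N -> (1 + lT) ^+ n <= 8 / 5.
Proof.
have /andP[l0 _] := lT_itv => nH.
apply: le_trans (_ : (1 + lT) ^+ H <= _); first by rewrite ler_weXn2l//; lra.
apply: le_trans (expR_9_20_le R).
have -> : 9 / 20 = H%:R * lT :> R by rewrite /chernoff_scale mulrCA divff ?mulr1// gt_eqF.
by rewrite expRM_natl lerXn2r ?nnegrE ?expR_ge0 ?expR_ge1Dx//; lra.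
Qed.

Lemma cap_room n : (n <= H)%N -> capC + (1 + lT) ^+ n * H%:R <= capB.
Proof.
move=> nH; rewrite /capC /capB.
have := ler_wpM2r (ltW HR) (discount_le n nH); lra.
Qed.

Definition good jo : bool := (5 * H <= jo.+1 * N)%N.

Definition traj_exponent (l : R) w : R :=
  \sum_(jo < K | good jo)
    (l * clipped_value w jo - l * cap R capB capC (cost w jo) - l ^+ 2 * capB * H%:R / 2).

Lemma traj_exponent_mgf (l : R) : 0 <= l -> l * capB <= 2 ->
  \sum_(w : Run) massw w * expR (traj_exponent l w) <= 1.
Proof.
move=> l0 lB.
have /andP[lT0 _] := lT_itv.
pose f w jo := if good jo then
  l * clipped_value w jo - l * cap R capB capC (cost w jo) - l ^+ 2 * capB * H%:R / 2 else 0.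
pose F (jo : 'I_K) w := ep_weight R S A H K N P r init p pick w jo * expR (f w jo).
have := run_sum_le1 R S A H K N init F.
under [X in _ -> _ -> _ -> X <= _]eq_bigr => w _ do
  rewrite big_split /= -massE -expR_sum -big_mkcond /=.
apply.
- by move=> j w; rewrite mulr_ge0 ?expR_ge0// ep_weight_ge0.
- move=> j w w' aw; rewrite /F (ep_weight_adapted R S A H K N P r init p pick j w w' aw).
  have aw' := agreeW _ _ _ _ _ _ (leqnSn _) aw.
  have wj : w j = w' j by move/agreeP: aw; apply.
  have e1 : (w j).1 = (w' j).1 by rewrite wj.
  rewrite /f /clipped_value /cost (eq_gcost _ _ _ aw') wj.
  by rewrite (eq_policy_of R S A H K N r init p pick _ _ _ aw' e1).
move=> jo w; apply: (ep_weight_sum_le R S A H K N P r init p pick P_ge0 P_sum1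
  (fun u => expR (f u jo))) => x t'.
rewrite /f; case: (good jo) => /=; last first.
  by under eq_bigr do rewrite expR0 mulr1; rewrite trajw_sum1.
pose u t : Run := upd w jo (x, t).
(* With the draws [x] fixed, costs and policy are the same for all trajectories of the episode, as
   [traj_mgf] requires. *)
have eg t : gcost (u t) jo = gcost w jo by apply: eq_gcost; exact: agree_upd.
have ep t : policy (u t) jo = policy (u t') jo.
  by apply: eq_policy_of; [exact: agree_upd2|rewrite !upd_same].
under eq_bigr => t _ do
  rewrite /clipped_value /cost -/(u t) (eg t) (ep t) [(u t) jo]upd_same /=.
rewrite -/(u t').
apply: traj_mgf => //.
- by move=> s a; exact: gcost_ge0.
- by lra.
- by have h0 := HR; rewrite /capC; lra.
- exact: cap_room.
Qed.

Hypothesis K_large : 2 * L <= K%:R.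

(** * Regret of one run on which the deviation bounds hold *)

Section Run.
Variable w : Run.
Hypothesis dV : forall jo s a m b, (m < H)%N ->
  sample_sum R S A H K N r init p pick w jo s a
    (value_exponent R S A H K N P r p pick b m (nobs w jo s a) s a) < 2 * L.
Hypothesis dT : forall jo s a (T : {set S}),
  sample_sum R S A H K N r init p pick w jo s a (set_exponent R S A H P T s a) < L + #|S|%:R.

Local Notation gap jo := (Vstar P r pick H (init jo) -
  Vpol P r pick (Qk r p pick w jo (hist w jo)) H (init jo)).

Lemma gap_le_clipped_value jo : gap jo <= clipped_value w jo.
Proof.
have l0 : 0 <= lT by have /andP[/ltW] := lT_itv.
have devV_le m s a (mH : (m < H)%N) := dev_value R S A H K N P r init p pick H_gt0 N_gt0
  P_ge0 P_sum1 r01 L2 w jo s a m (ltnW mH) (fun b => dV jo s a m b mH).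
have devT_le s a T := dev_set R S A H K N P r init p pick H_gt0 N_gt0 w jo s a T (dT jo s a T).
have Ph0 := Phat_ge0 R S A H K N r init p pick w jo.
have h1 := Vstar_le_Vhat R S A H P r pick P_ge0 P_sum1 r01 pick_max _ _ _ Ph0
  (value_radius_le_bonus w jo) devV_le H (init jo) (leqnn H).
have h2 := Vhat_sub_Vpol_le R S A H P r pick P_ge0 P_sum1 r01 pick_max _ _ _ _ _ Ph0 l0
  (value_radius_le_bonus w jo) devV_le devT_le H (init jo) (leqnn H).
by apply: le_trans h2; rewrite lerD2r.
Qed.

Definition rate : R := (2 * H%:R - 1) / (N%:R + 2 * H%:R - 1).

Lemma rate_gt0 : 0 < rate.
Proof. by have h1 := HR1; have n1 := NR; rewrite divr_gt0//; lra. Qed.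

(** Cross-multiplication reduces the claim to [0 <= (H - 1) * N]. *)
Lemma spread_le_rate : spread R H N <= 6 / 5 * rate.
Proof.
have h1 := HR1; have n1 := NR; rewrite /spread /rate.
have hn : 0 <= (H%:R - 1) * N%:R :> R by rewrite mulr_ge0//; lra.
rewrite ler_wpM2l ?divr_ge0// ler_pdivrMr; last by lra.
rewrite mulrAC ler_pdivlMr; last by lra.
lra.
Qed.

(** 2191/2000 is a rational just above the square root of 6/5. *)
Lemma sqrt_spread_le : Num.sqrt (spread R H N) <= 2191 / 2000 * Num.sqrt rate.
Proof.
have r0 := rate_gt0.
have -> : 2191 / 2000 * Num.sqrt rate = Num.sqrt ((2191 / 2000) ^+ 2 * rate).
  by rewrite (sqrtrM rate (sqr_ge0 (2191 / 2000))) sqrtr_sqr ger0_norm// divr_ge0.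
have sr := spread_le_rate; rewrite ler_sqrt; first by lra.
by rewrite mulr_ge0 ?sqr_ge0// ltW.
Qed.

Lemma gap_le_H jo : gap jo <= H%:R.
Proof.
have := Vstar_itv R S A P r pick P_ge0 P_sum1 r01 H (init jo).
have := Vpol_itv R S A P r pick P_ge0 r01 pick_max (Qk r p pick w jo (hist w jo)) H (init jo).
lra.
Qed.

Lemma card_bad_le : \sum_(jo < K | ~~ good jo) N%:R <= 5 * H%:R :> R.
Proof.
rewrite /good; elim: K => [|k IHk]; first by rewrite big_ord0 mulr_ge0.
rewrite big_mkcond big_ord_recr -big_mkcond /=.
case: ifPn => [bad|_]; last by rewrite addr0.
(* If the last episode is bad then [k.+1 * N < 5 * H], so all [k.+1] episodes can be counted. *)
apply: le_trans (_ : \sum_(jo < k.+1) N%:R <= _).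
  rewrite big_ord_recr /= lerD2r [leRHS](bigID (fun jo : 'I_k => ~~ (5 * H <= jo.+1 * N)%N)) /=.
  by rewrite lerDl sumr_ge0.
rewrite sumr_const card_ord -[N%:R *+ _]mulr_natr.
have : (N * k.+1 <= 5 * H)%N by move: bad; rewrite -ltnNge mulnC => /ltnW.
by rewrite -(ler_nat R) (natrM _ N) (natrM _ 5).
Qed.

(** At most [5 * H / N] episodes cost [H] each, and [1 / N <= 2 * rate]. The resulting factor 10
    becomes 5/2 because [#|S| ^ 2 * #|A| * L ^ 2] is at least 4. *)
Lemma sum_bad_le : \sum_(jo < K | ~~ good jo) gap jo <=
  5 / 2 * rate * #|S|%:R ^+ 2 * #|A|%:R * H%:R ^+ 2 * L ^+ 2.
Proof.
have h1 := HR1; have n1 := NR; have l2 := L2; have s1 := SR; have a1 := AR.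
have r0 := rate_gt0.
have e0 : 0 < N%:R + 2 * H%:R - 1 :> R by lra.
have rN : 1 / 2 <= rate * N%:R.
  rewrite /rate mulrAC ler_pdivlMr//.
  have : 0 <= (N%:R - 1) * (2 * H%:R - 1 - 1) :> R by rewrite mulr_ge0//; lra.
  lra.
have c1 : \sum_(jo < K | ~~ good jo) gap jo <= \sum_(jo < K | ~~ good jo) H%:R.
  by apply: ler_sum => jo _; exact: gap_le_H.
apply: le_trans c1 _; have := card_bad_le; rewrite !sumr_const.
set c := #|_|; rewrite -[N%:R *+ c]mulr_natr -[H%:R *+ c]mulr_natr => cN.
have cr : c%:R <= 10 * (rate * H%:R).
  have : rate * (N%:R * c%:R) <= rate * (5 * H%:R) by rewrite ler_wpM2l// ltW.
  have : 1 / 2 * c%:R <= (rate * N%:R) * c%:R by rewrite ler_wpM2r.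
  lra.
have l4 : 4 <= L ^+ 2 by rewrite expr2; have := ler_pM (ler0n R 2) (ler0n R 2) l2 l2; lra.
have sa1 : 1 <= #|S|%:R ^+ 2 * #|A|%:R :> R.
  by rewrite -[leLHS]mulr1 ler_pM// exprn_ege1.
have rH : 0 <= rate * H%:R ^+ 2 by rewrite mulr_ge0 ?sqr_ge0// ltW.
have sal : 4 <= #|S|%:R ^+ 2 * #|A|%:R * L ^+ 2.
  by rewrite -[leLHS]mul1r ler_pM.
have := ler_wpM2l rH sal.
have := ler_wpM2l (ltW HR) cr.
lra.
Qed.

Lemma capB_ge0 : 0 <= capB. Proof. by have h0 := HR; rewrite /capB; lra. Qed.

Lemma cap_le (y : R) : 0 <= y -> cap R capB capC y <= 17 / 9 * y.
Proof. by move=> y0; rewrite /cap; case: ltP; rewrite /capB /capC; lra. Qed.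

Lemma cost_le jo : cost w jo <= 8 / 5 * \sum_(h < H)
  (9 * H%:R * L / Num.sqrt (visits R S A H K N r init p pick w jo
      (cur init w jo h, act r init p pick w jo (hist w jo) h) + jo.+1 * N)%:R +
   10 / 3 * #|S|%:R * H%:R ^+ 2 * L / (visits R S A H K N r init p pick w jo
      (cur init w jo h, act r init p pick w jo (hist w jo) h) + jo.+1 * N)%:R).
Proof.
have /andP[l0 _] := lT_itv.
rewrite /cost /tcost (eq_bigl xpredT) => [|h]; last by rewrite ltn_ord.
rewrite mulr_sumr; apply: ler_sum => h _.
apply: ler_pM; [by rewrite exprn_ge0//; lra|exact: gcost_ge0| |].
  by apply: discount_le; exact: ltnW.
exact: gcost_le.
Qed.

(** The cap costs a factor 17/9 and the compounding 8/5. Then 60 bounds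
    [17/9 * 8/5 * 18 * 2191/2000], and 25/2 bounds [17/9 * 8/5 * 4], where [4 = 10/3 * 6/5]. *)
Lemma sum_cap_le : \sum_(jo < K | good jo) cap R capB capC (cost w jo) <=
  60 * Num.sqrt rate * (H%:R * Num.sqrt H%:R) * L * Num.sqrt (#|S|%:R * #|A|%:R * K%:R)
  + 25 / 2 * rate * #|S|%:R ^+ 2 * #|A|%:R * H%:R ^+ 2 * L ^+ 2.
Proof.
have h1 := HR1; have n1 := NR; have l2 := L2; have s1 := SR; have a1 := AR.
have r0 := rate_gt0.
have al0 : 0 <= 9 * H%:R * L by rewrite !mulr_ge0//; lra.
have be0 : 0 <= 10 / 3 * #|S|%:R * H%:R ^+ 2 * L.
  by apply: mulr_ge0; [rewrite !mulr_ge0 ?sqr_ge0 ?invr_ge0|lra].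
have main := sum_inv_counts R S A H K N r init p pick w H_gt0 K_gt0 _ _ al0 be0.
set T := (X in X <= _) in main.
have capT : \sum_(jo < K | good jo) cap R capB capC (cost w jo) <= 17 / 9 * (8 / 5 * T).
  rewrite /T !mulr_sumr; apply: ler_sum => jo _.
  apply: le_trans (cap_le _ (tcost_ge0 _ _ _ _ _ _ _ _ _ _ _ _)) _.
  - by move=> s a; exact: gcost_ge0.
  - by have /andP[l0 _] := lT_itv; lra.
  - by apply: ler_wpM2l; [rewrite divr_ge0|exact: cost_le].
apply: le_trans capT _.
have LK : 1 + ln (K * H)%:R <= L by apply: LN_ge_lnKH => //; [exact: S_gt0|exact: A_gt0].
set X := H%:R * Num.sqrt H%:R * L * Num.sqrt (#|S|%:R * #|A|%:R * K%:R).
set Y := #|S|%:R ^+ 2 * #|A|%:R * H%:R ^+ 2 * L ^+ 2.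
have X0 : 0 <= X by rewrite /X !mulr_ge0 ?sqrtr_ge0//; lra.
have Y0 : 0 <= Y.
  by rewrite /Y mulr_ge0 ?sqr_ge0// mulr_ge0 ?sqr_ge0// mulr_ge0 ?sqr_ge0.
have t1 : 9 * H%:R * L * (2 * Num.sqrt (spread R H N) *
    Num.sqrt ((#|S| * #|A|)%:R * (K * H)%:R)) <= 18 * (2191 / 2000 * Num.sqrt rate) * X.
  have -> : Num.sqrt ((#|S| * #|A|)%:R * (K * H)%:R) =
      Num.sqrt (H%:R) * Num.sqrt (#|S|%:R * #|A|%:R * K%:R) :> R.
    by rewrite -sqrtrM// !natrM; congr Num.sqrt; ring.
  have := ler_wpM2r X0 sqrt_spread_le; rewrite /X; lra.
have t2 : 10 / 3 * #|S|%:R * H%:R ^+ 2 * L * (spread R H N *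
    ((#|S| * #|A|)%:R * (1 + ln (K * H)%:R))) <= 4 * rate * Y.
  have d0 : 0 <= #|S|%:R * #|A|%:R :> R by rewrite mulr_ge0.
  have := ler_pM (ltW (spread_gt0 R H N H_gt0)) _ spread_le_rate (ler_wpM2l d0 LK).
  have ln0 : 0 <= ln (K * H)%:R :> R by rewrite ln_ge0// ler1n muln_gt0 K_gt0.
  move=> /(_ (mulr_ge0 d0 (addr_ge0 ler01 ln0))) h.
  have := ler_wpM2l be0 h; rewrite (natrM _ #|S|) /Y; lra.
have rX : 0 <= Num.sqrt rate * X by rewrite mulr_ge0 ?sqrtr_ge0.
have rY : 0 <= rate * Y by rewrite mulr_ge0// ltW.
have -> : 60 * Num.sqrt rate * (H%:R * Num.sqrt H%:R) * L *
  Num.sqrt (#|S|%:R * #|A|%:R * K%:R) = 60 * (Num.sqrt rate * X) by rewrite /X; ring.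
have -> : 25 / 2 * rate * #|S|%:R ^+ 2 * #|A|%:R * H%:R ^+ 2 * L ^+ 2 =
  25 / 2 * (rate * Y) by rewrite /Y; ring.
move: main t1 t2 rX rY; lra.
Qed.

(** Nearly minimizes [l * K * capB * H / 2 + L / l] over [l]; 13/10 approximates the square root of
    17/10. *)
Definition dev_scale : R := 10 / (13 * H%:R) * Num.sqrt (L / K%:R).

Lemma dev_scale_gt0 : 0 < dev_scale.
Proof.
have h0 := HR; have l2 := L2; have k1 := KR.
by rewrite mulr_gt0 ?divr_gt0 ?mulr_gt0// sqrtr_gt0 divr_gt0//; lra.
Qed.

Lemma dev_scale_le : dev_scale * capB <= 2.
Proof.
have h0 := HR; have k1 := KR.
(* [K_large] gives [L / K <= 1/2], below 9/16; and [34/13 * 3/4] is below 2. *)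
have q : Num.sqrt (L / K%:R) <= 3 / 4.
  have -> : 3 / 4 = Num.sqrt ((3 / 4) ^+ 2) :> R by rewrite sqrtr_sqr ger0_norm// divr_ge0.
  rewrite ler_sqrt ?sqr_ge0// ler_pdivrMr; last by lra.
  by have := K_large; lra.
have -> : dev_scale * capB = 34 / 13 * Num.sqrt (L / K%:R).
  by rewrite /dev_scale /capB; field; rewrite gt_eqF.
lra.
Qed.

Hypothesis dZ : traj_exponent dev_scale w < L.

Lemma sum_good_le : \sum_(jo < K | good jo) gap jo <=
  261 / 100 * H%:R * Num.sqrt (K%:R * L) + \sum_(jo < K | good jo) cap R capB capC (cost w jo).
Proof.
have h0 := HR; have l2 := L2; have k1 := KR; have s0 := dev_scale_gt0.
have k0 : 0 < K%:R :> R by lra.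
apply: le_trans (_ : \sum_(jo < K | good jo) clipped_value w jo <= _).
  by apply: ler_sum => jo _; exact: gap_le_clipped_value.
set D := \sum_(jo < K | good jo) clipped_value w jo; set Z := \sum_(jo < K | good jo) cap _ _ _ _.
set q : R := Num.sqrt (K%:R * L).
have q0 : 0 < q by rewrite sqrtr_gt0 mulr_gt0//; lra.
have qq : q ^+ 2 = K%:R * L by rewrite sqr_sqrtr// mulr_ge0//; lra.
have sE : dev_scale = 10 / (13 * H%:R) * (q / K%:R).
  rewrite /dev_scale; congr (_ * _).
  have -> : L / K%:R = (q / K%:R) ^+ 2 by rewrite expr_div_n qq; field; rewrite gt_eqF.
  by rewrite sqrtr_sqr ger0_norm// divr_ge0// ltW.
have cst : \sum_(jo < K | good jo) (dev_scale ^+ 2 * capB * H%:R / 2) <=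
    K%:R * (dev_scale ^+ 2 * capB * H%:R / 2).
  have c0 : 0 <= dev_scale ^+ 2 * capB * H%:R / 2.
    apply: divr_ge0 => //; apply: mulr_ge0 => //.
    by apply: mulr_ge0; [exact: sqr_ge0|exact: capB_ge0].
  rewrite mulr_natl -[in leRHS](card_ord K) -sumr_const big_mkcond.
  by apply: ler_sum => jo _; case: ifP.
have := dZ; rewrite /traj_exponent 2!sumrB -2!mulr_sumr -/D -/Z => h.
have h2 : dev_scale * D <= dev_scale * Z + K%:R * (dev_scale ^+ 2 * capB * H%:R / 2) + L.
  lra.
rewrite -(ler_pM2l s0); apply: le_trans h2 _.
have e1 : K%:R * (dev_scale ^+ 2 * capB * H%:R / 2) =
    dev_scale * (17 / 13 * H%:R * q).
  by rewrite sE /capB; field; rewrite !gt_eqF.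
have e2 : L = dev_scale * (13 / 10 * H%:R * q).
  rewrite sE; have -> : L = q ^+ 2 / K%:R by rewrite qq mulrAC divff ?mul1r// gt_eqF.
  by field; rewrite !gt_eqF.
(* The two contributions add up to [17/13 + 13/10], below 261/100. *)
rewrite e1 [X in _ + X]e2 -!mulrDr ler_pM2l//.
have := mulr_ge0 (ltW h0) (ltW q0); lra.
Qed.

(** The constant 15 collects 25/2 from the good episodes and 5/2 from the bad ones; 261/100 is below
    e. *)
Lemma regret_le : regret P r init p pick w <= regret_bound S A H K N p.
Proof.
have h1 := HR1; have n1 := NR; have l2 := L2; have s1 := SR; have a1 := AR.
rewrite /regret (bigID good) /= /regret_bound.
have q0 : 0 <= H%:R * Num.sqrt (K%:R * L) by rewrite mulr_ge0 ?sqrtr_ge0.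
have e1 : 261 / 100 * H%:R * Num.sqrt (K%:R * L) <= expR 1 * (H%:R + 1) * Num.sqrt (K%:R * L).
  rewrite ler_wpM2r ?sqrtr_ge0//; have e := expR1_gt R.
  by apply: ler_pM => //; lra.
have t0 : 0 <= #|S|%:R * #|A|%:R * H%:R ^+ 2 / (N%:R + 1) :> R.
  by rewrite divr_ge0 ?mulr_ge0 ?sqr_ge0//; lra.
have sc := sum_cap_le; have sg := sum_good_le; have sb := sum_bad_le.
rewrite -/rate; lra.
Qed.

End Run.

End Regret.

(** * Runs with few episodes, and assembly of the bound *)

Lemma regret_le_short (R : realType) (S A : finType) (H K N : nat)
  (P : S -> A -> S -> R) (r : S -> A -> R) (init : 'I_K -> S) (p : R)
  (pick : (A -> R) -> A) (w : Om S A H K N) :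
  (0 < H)%N -> (0 < K)%N -> (0 < N)%N ->
  (forall s a s', 0 <= P s a s') ->
  (forall s a, \sum_(s' : S) P s a s' = 1) ->
  (forall s a, 0 <= r s a <= 1) ->
  (forall (f : A -> R) (a : A), f a <= f (pick f)) ->
  2 <= LN S A H K N p -> K%:R < 2 * LN S A H K N p ->
  regret P r init p pick w <= regret_bound S A H K N p.
Proof.
move=> H0 K0 N0 P0 P1 r01 pick_max; set L := LN _ _ _ _ _ _ => L2 KL.
have h1 : 1 <= H%:R :> R by rewrite ler1n.
have n1 : 1 <= N%:R :> R by rewrite ler1n.
have k1 : 1 <= K%:R :> R by rewrite ler1n.
have rKH : regret P r init p pick w <= K%:R * H%:R.
  rewrite mulr_natl -[in leRHS](card_ord K) -sumr_const.
  by apply: ler_sum => jo _; exact: gap_le_H.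
apply: le_trans rKH _; rewrite /regret_bound -/L -/(rate R H N).
have r0 := rate_gt0 R H N H0 N0.
(* [K ^ 2 < 2 * K * L], and 3/2 exceeds the square root of 2; hence [K * H] is below the term with
   the factor e. *)
have kl : K%:R <= 3 / 2 * Num.sqrt (K%:R * L).
  have -> : 3 / 2 * Num.sqrt (K%:R * L) = Num.sqrt ((3 / 2) ^+ 2 * (K%:R * L)).
    by rewrite (sqrtrM _ (sqr_ge0 (3 / 2))) sqrtr_sqr ger0_norm// divr_ge0.
  have {1}-> : K%:R = Num.sqrt (K%:R ^+ 2) :> R by rewrite sqrtr_sqr ger0_norm.
  have kk : K%:R * K%:R <= K%:R * (2 * L) by rewrite ler_wpM2l// ltW.
  have k0 : 0 <= K%:R * L by rewrite mulr_ge0//; lra.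
  by rewrite ler_sqrt ?mulr_ge0 ?sqr_ge0//; lra.
set q := Num.sqrt (K%:R * L) in kl *.
have q0 : 0 <= q by exact: sqrtr_ge0.
have t1 : K%:R * H%:R <= expR 1 * (H%:R + 1) * q.
  have e := expR1_gt R.
  apply: le_trans (_ : 3 / 2 * q * H%:R <= _); first by rewrite ler_wpM2r//; lra.
  have : (261 / 100) * H%:R <= expR 1 * (H%:R + 1) :> R by apply: ler_pM => //; lra.
  move=> /(ler_wpM2r q0); have := mulr_ge0 q0 (ler0n R H); lra.
have t0 : 0 <= #|S|%:R * #|A|%:R * H%:R ^+ 2 / (N%:R + 1) :> R.
  by rewrite divr_ge0 ?mulr_ge0 ?sqr_ge0//; lra.
have t2 : 0 <= 60 * Num.sqrt (rate R H N) * (H%:R * Num.sqrt H%:R) * L *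
    Num.sqrt (#|S|%:R * #|A|%:R * K%:R).
  apply: mulr_ge0; last exact: sqrtr_ge0.
  apply: mulr_ge0; last by lra.
  by rewrite !mulr_ge0 ?sqrtr_ge0.
have t3 : 0 <= 15 * rate R H N * #|S|%:R ^+ 2 * #|A|%:R * H%:R ^+ 2 * L ^+ 2.
  apply: mulr_ge0; last exact: sqr_ge0.
  apply: mulr_ge0; last exact: sqr_ge0.
  by rewrite mulr_ge0// mulr_ge0 ?sqr_ge0// mulr_ge0// ltW.
lra.
Qed.

Theorem theorem3 (R : realType) (S A : finType) (H K N : nat)
  (P : S -> A -> S -> R) (r : S -> A -> R) (init : 'I_K -> S) (p : R)
  (pick : (A -> R) -> A) :
  (0 < H)%N -> (0 < K)%N -> (1 <= N)%N ->
  0 < p < 1 ->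
  (forall s a s', 0 <= P s a s') ->
  (forall s a, \sum_(s' : S) P s a s' = 1) ->
  (forall s a, 0 <= r s a <= 1) ->
  (forall (f : A -> R) (a : A), f a <= f (pick f)) ->
  1 - p <=
    @Prob R S A H K N P r init p pick
      (fun w => @regret R S A H K N P r init p pick w
                <= @regret_bound R S A H K N p).
Proof.
move=> H0 K0 N0 p01 P0 P1 r01 pick_max.
have S0 : (0 < #|S|)%N := S_gt0 S K init K0.
have A0 : (0 < #|A|)%N := A_gt0 R A pick.
have L2 := LN_ge2 R S A H K N p S0 A0 H0 K0 N0 p01.
have [KL|LK] := ltP K%:R (2 * LN S A H K N p).
  (* With few episodes the bound holds on every run, so an empty family of events suffices. *)
  apply: (Prob_ge R S A H K N P r init p pick P0 P1 void (fun _ _ => 0) (fun _ => 0)).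
  - by case.
  - by rewrite big_pred0 => [|[]//]; have /andP[/ltW] := p01.
  - by move=> w _; exact: regret_le_short.
pose l := dev_scale R S A H K N p.
(* Three families: masses of sets, averages of V*, and the trajectory costs. The index [n] starts at
   0 while counts are positive, hence [n.+1]; it is later taken to be the predecessor of the actual
   count. *)
pose X (i : 'I_K * S * A * {set S} + 'I_K * S * A * 'I_H * 'I_(K * (H + N)) * bool + unit)
    (w : Om S A H K N) : R :=
  match i with
  | inl (inl (jo, s, a, T)) =>
      sample_sum R S A H K N r init p pick w jo s a (set_exponent R S A H P T s a)
  | inl (inr (jo, s, a, m, n, b)) =>
      sample_sum R S A H K N r init p pick w jo s a
        (value_exponent R S A H K N P r p pick b m n.+1 s a)
  | inr _ => traj_exponent R S A H K N P r init p pick l w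
  end.
pose th (i : 'I_K * S * A * {set S} + 'I_K * S * A * 'I_H * 'I_(K * (H + N)) * bool + unit) :=
  match i with
  | inl (inl _) => LN S A H K N p + #|S|%:R
  | inl (inr _) => 2 * LN S A H K N p
  | inr _ => LN S A H K N p
  end.
apply: (Prob_ge R S A H K N P r init p pick P0 P1 _ X th).
- case=> [[[[[jo s] a] T]|[[[[[jo s] a] m] n] b]]|_] /=.
  + exact: set_exponent_mgf.
  + by apply: value_exponent_mgf => //; exact: ltnW.
  + apply: traj_exponent_mgf => //; first by apply: ltW; exact: dev_scale_gt0.
    exact: dev_scale_le.
- rewrite !big_sumType /= [X in _ + _ + X]big_const.
  have := family_weights R S A H K N p S0 A0 H0 K0 N0 p01.
  by rewrite card_unit /= addr0.
- move=> w Xth; apply: regret_le => //.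
  + move=> jo s a m b mH.
    set n := nobs R S A H K N r init p pick w jo s a.
    have n0 : (0 < n)%N by apply: nobs_gt0.
    have nK : (n.-1 < K * (H + N))%N by rewrite prednK//; exact: nobs_le.
    have := Xth (inl (inr (jo, s, a, Ordinal mH, Ordinal nK, b))).
    by rewrite /= prednK.
  + by move=> jo s a T; exact: (Xth (inl (inl (jo, s, a, T)))).
  + exact: (Xth (inr tt)).
Qed.
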